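(* Let $p\in(1,2]$, let $X,E$ be Banach spaces and let $f\in\mathrm{Lip}_0(X,E)$. The following assertions are equivalent: (i) $f\in\mathcal{T}_p^{\mathrm{Lip}_0}(X,E)$, i.e. $f$ has type $p$. (ii) $\hat f\in\mathrm{Lip}_0(\ell_p(X),\mathrm{RAD}(E))$. (iii) $\hat f\in\mathrm{Lip}_0(\ell_p(X),\mathrm{Rad}(E))$. Furthermore (when these hold), $\mathrm{Lip}(\hat f:\ell_p(X)\to\mathrm{RAD}(E))=\mathrm{Lip}(\hat f:\ell_p(X)\to\mathrm{Rad}(E))=\|f\|_{\mathcal{T}_p^{\mathrm{Lip}}}$.
   Context: For Banach spaces $X,E$, $\mathrm{Lip}_0(X,E)$ is the Banach space of Lipschitz maps $f:X\to E$ with $f(0)=0$, normed by $\mathrm{Lip}(f)=\sup_{x\ne y}\|f(x)-f(y)\|/\|x-y\|$. For $f\in \mathrm{Lip}_0(X,E)$, $\hat f$ denotes the coordinatewise map $\hat f((x_n)_n)=(f(x_n))_n$; writing $\hat f\in\mathrm{Lip}_0(A,B)$ for sequence spaces $A\subseteq X^{\mathbb{N}}$, $B\subseteq E^{\mathbb{N}}$ means that $\hat f$ maps $A$ into $B$ and is Lipschitz. $(r_n)_{n\in\mathbb{N}}$ are the Rademacher functions on $[0,1]$. $\ell_p(X)$ is the space of $X$-valued sequences with $\|(x_n)_n\|_{\ell_p(X)}=(\sum_n\|x_n\|^p)^{1/p}<\infty$. $\mathrm{Rad}(E)$ is the space of sequences $(x_n)_n\in E^{\mathbb{N}}$ such that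 $\sum_n r_n x_n$ converges in $L_s([0,1],E)$ for all $s\in(0,\infty)$, with norm $\|(x_n)_n\|_{\mathrm{Rad}(E)}=\left(\int_0^1\|\sum_{i=1}^\infty r_i(t)x_i\|_E^2\,dt\right)^{1/2}$. $\mathrm{RAD}(E)$ is the space of sequences $(x_n)_n\in E^{\mathbb{N}}$ with $\|(x_n)_n\|_{\mathrm{RAD}(E)}=\sup_N\|(x_1,\ldots,x_N,0,0,\ldots)\|_{\mathrm{Rad}(E)}<\infty$. $f\in\mathrm{Lip}_0(X,E)$ has type $p$ if there is $C>0$ such that for all $N\in\mathbb{N}$, $(\lambda_1,\ldots,\lambda_N)\in\mathbb{R}^N$ and $(x_1,\ldots,x_N),(y_1,\ldots,y_N)\in X^N$, $$\left(\int_0^1\Big\|\sum_{k=1}^N\lambda_k r_k(t)(f(x_k)-f(y_k))\Big\|_E^2dt\right)^{1/2}\le C\left(\sum_{k=1}^N|\lambda_k|^p\|x_k-y_k\|_X^p\right)^{1/p}.$$ The set of such $f$ is $\mathcal{T}_p^{\mathrm{Lip}_0}(X,E)$ and $\|f\|_{\mathcal{T}_p^{\mathrm{Lip}}}$ is the infimum of all such $C$. *)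

(* Defs.v *)
(* The Banach spaces are real: X E : completeNormedModType R
   with R : realType. *)
From HB Require Import structures.
From mathcomp Require Import all_boot all_order all_algebra.
From mathcomp Require Import all_classical all_reals all_analysis.

Set Implicit Arguments.
Unset Strict Implicit.
Unset Printing Implicit Defensive.
Import Order.TTheory GRing.Theory Num.Theory.
Import numFieldNormedType.Exports.
Local Open Scope classical_set_scope.
Local Open Scope ring_scope.

Definition Lip0 (R : realType) (X E : normedModType R) (f : X -> E) : Prop :=
  lipschitz f /\ f 0 = 0.

(* A sequence space: a set of sequences with a norm. The norm is a total
   function, meaningful only on the members. *)
Record seqspace (R : realType) (E : normedModType R) := SeqSpace {
  seqmem : set (nat -> E);
  seqnorm : (nat -> E) -> R }.

Definition Lip0_seq (R : realType) (X E : normedModType R)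
    (A : seqspace X) (B : seqspace E) (F : (nat -> X) -> (nat -> E)) : Prop :=
  [/\ forall x, seqmem A x -> seqmem B (F x),
      F (cst 0) = cst 0 &
      exists L : R, forall x y, seqmem A x -> seqmem A y ->
        seqnorm B (fun n => F x n - F y n) <= L * seqnorm A (fun n => x n - y n)].

(* [sup] of the reals is 0 on the empty set, which is the right value
   Lip(F) = 0 when A is the zero space; it is a genuine supremum whenever F is
   Lipschitz from A to B. *)
Definition Lip_seq (R : realType) (X E : normedModType R)
    (A : seqspace X) (B : seqspace E) (F : (nat -> X) -> (nat -> E)) : R :=
  sup [set r | exists x y, [/\ seqmem A x, seqmem A y, x <> y &
    r = seqnorm B (fun n => F x n - F y n) / seqnorm A (fun n => x n - y n)]].

Definition hat (X E : Type) (f : X -> E) (x : nat -> X) : nat -> E :=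
  fun n => f (x n).

Definition ellp_norm (R : realType) (X : normedModType R) (p : R)
    (x : nat -> X) : \bar R :=
  ((\sum_(0 <= n <oo) (`|x n| `^ p)%:E) `^ p^-1)%E.

Definition ellp (R : realType) (X : normedModType R) (p : R) : seqspace X :=
  SeqSpace [set x | (ellp_norm p x < +oo)%E] (fun x => fine (ellp_norm p x)).

(* Sequences are indexed from 0, so [rademacher n] is r_(n+1), that is
   t |-> sgn (sin (2 ^ (n + 1) pi t)). *)
Definition rademacher (R : realType) (n : nat) (t : R) : R :=
  Num.sg (sin (2 ^+ n.+1 * pi * t)).

Definition int01 (R : realType) (g : R -> R) : \bar R :=
  (\int[@lebesgue_measure R]_(t in `[0%R, 1%R]) (g t)%:E)%E.

Definition simple_fun (R : realType) (E : normedModType R) (h : R -> E) : Prop :=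
  finite_set (range h) /\ forall v : E, measurable (h @^-1` [set v]).

Definition strongly_measurable01 (R : realType) (E : normedModType R)
    (g : R -> E) : Prop :=
  exists h : nat -> R -> E, (forall k, simple_fun (h k)) /\
    forall t : R, 0 <= t <= 1 -> h ^~ t @ \oo --> g t.

(* Representatives of the elements of L_s([0,1], E): every class of
   a.e. strongly measurable functions contains a strongly measurable one. *)
Definition in_Ls (R : realType) (E : normedModType R) (s : R) (g : R -> E) : Prop :=
  strongly_measurable01 g /\ (int01 (fun t => (`|g t| `^ s)%R) < +oo)%E.

Definition rad_partial (R : realType) (E : normedModType R) (x : nat -> E)
    (N : nat) (t : R) : E :=
  \sum_(n < N) rademacher n t *: x n.

(* The representatives of the sum in L_s([0,1], E) of the series
   of general term r_n x_n. *)
Definition rad_sums (R : realType) (E : normedModType R) (s : R)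
    (x : nat -> E) : set (R -> E) :=
  [set g | in_Ls s g /\
    (int01 (fun t => `|rad_partial x N t - g t| `^ s) @[N --> \oo] --> 0%E)].

Definition L2norm01 (R : realType) (E : normedModType R) (g : R -> E) : \bar R :=
  (int01 (fun t => (`|g t| ^+ 2)%R) `^ (2^-1)%R)%E.

(* Any two members of [rad_sums 2 x] agree a.e., so the norm does not depend on
   the choice made by [xget]. *)
Definition Rad_norm (R : realType) (E : normedModType R) (x : nat -> E) : \bar R :=
  L2norm01 (xget (cst 0) (rad_sums 2 x)).

Definition Rad (R : realType) (E : normedModType R) : seqspace E :=
  SeqSpace [set x : nat -> E | forall s : R, 0 < s -> rad_sums s x !=set0]
           (fun x => fine (Rad_norm x)).

Definition truncate_seq (E : zmodType) (N : nat) (x : nat -> E) : nat -> E :=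
  fun n => if (n < N)%N then x n else 0.

Definition RAD_norm (R : realType) (E : normedModType R) (x : nat -> E) : \bar R :=
  ereal_sup (range (fun N => Rad_norm (truncate_seq N x))).

Definition RAD (R : realType) (E : normedModType R) : seqspace E :=
  SeqSpace [set x : nat -> E | (RAD_norm x < +oo)%E] (fun x => fine (RAD_norm x)).

Definition type_ineq (R : realType) (X E : normedModType R) (p : R)
    (f : X -> E) (C : R) : Prop :=
  forall (N : nat) (lambda : 'I_N -> R) (x y : 'I_N -> X),
    (L2norm01 (fun t : R =>
       (\sum_(k < N) (lambda k * rademacher k t) *: (f (x k) - f (y k)))%R) <=
     (C * (\sum_(k < N) `|lambda k| `^ p * `|x k - y k| `^ p) `^ p^-1)%R%:E)%E.

Definition type_class (R : realType) (X E : normedModType R) (p : R)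
    : set (X -> E) :=
  [set f | Lip0 f /\ exists2 C : R, 0 < C & type_ineq p f C].

Definition type_norm (R : realType) (X E : normedModType R) (p : R)
    (f : X -> E) : R :=
  inf [set C : R | 0 < C /\ type_ineq p f C].

(* Main.v *)
(** The weights [lambda_k] in the definition of type are removed by convexity.
    When [lambda_k = 1 / m], cutting the segment from [y_k] to [x_k] into [m]
    equal pieces exhibits [lambda_k (f x_k - f y_k)] as a mean of increments of
    [f] at distance [|x_k - y_k| / m], and Rademacher square means are convex
    and even in each vector; homogeneity then reduces arbitrary weights to ones
    so small that they are nearly of the form [1 / m]. Conversely, type
    makes the Rademacher sums of [f x_n - f y_n] Cauchy in square mean, and
    Kahane's inequality (through the two-point inequality between the exponents
    2 and 4) turns this into convergence in every L_s. The norms of [Rad E] and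
    [RAD E] agree because Rademacher square means increase with the number of
    terms. *)
Require Import Defs.
From HB Require Import structures.
From mathcomp Require Import all_boot all_order all_algebra.
From mathcomp Require Import all_classical all_reals all_analysis.
From mathcomp Require Import measurable_realfun.
From mathcomp Require Import ring lra.
Import Order.TTheory GRing.Theory Num.Theory.
Import numFieldNormedType.Exports.
Local Open Scope classical_set_scope.
Local Open Scope ring_scope.

Set Implicit Arguments.
Unset Strict Implicit.
Unset Printing Implicit Defensive.

(** * Means over signs and Kahane's inequality *)

(** The obstacle is that [f] is not linear: [lam *: (f x - f y)] is in general no increment of [f],
    whereas a Lipschitz bound on [hat f] speaks only of unweighted increments. The convexity
    argument costs nothing in the constant because each weighted term is traded for a single
    increment, so the number of terms is unchanged, and the distances shrink by about [|lam|], which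
    matches the factor [|lam| ^ p] on the right. The only loss is a factor [1 / (1 - e)], with [e]
    arbitrarily small; hence the norms are equal and not merely equivalent. All integrals of
    Rademacher sums are reduced to finite averages: [signmean G s v] is the expectation of [G] at
    [v] plus the sum of the entries of [s] with independent uniform signs. Convexity, evenness and
    the hypercontractive estimate are then proved one sign at a time, the free base point [v]
    recording the signs already chosen. *)

Fixpoint signmean (R : realType) (V : zmodType) (G : V -> R) (s : seq V)
    (v : V) : R :=
  if s is z :: s' then
    (signmean G s' (v + z) + signmean G s' (v - z)) / 2
  else G v.

Definition cvx (R : realType) (V : lmodType R) (G : V -> R) : Prop :=
  forall t u w, 0 <= t <= 1 ->
    G (t *: u + (1 - t) *: w) <= t * G u + (1 - t) * G w.

Lemma le_signmean (R : realType) (V : zmodType) (G H : V -> R) s v :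
  (forall u, G u <= H u) -> signmean G s v <= signmean H s v.
Proof.
by move=> GH; elim: s v => [|z s IH] v //=; rewrite ler_pM2r// lerD.
Qed.

Lemma signmean_cst (R : realType) (V : zmodType) (c : R) s (v : V) :
  signmean (fun=> c) s v = c.
Proof. by elim: s v => [|z s IH] v //=; rewrite !IH; lra. Qed.

Lemma signmeanD (R : realType) (V : zmodType) (G H : V -> R) s v :
  signmean (fun u => G u + H u) s v = signmean G s v + signmean H s v.
Proof. by elim: s v => [|z s IH] v //=; rewrite !IH; lra. Qed.

Lemma signmeanM (R : realType) (V : zmodType) (c : R) (G : V -> R) s v :
  signmean (fun u => c * G u) s v = c * signmean G s v.
Proof. by elim: s v => [|z s IH] v //=; rewrite !IH; lra. Qed.

Lemma signmean_ge0 (R : realType) (V : zmodType) (G : V -> R) s v :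
  (forall u, 0 <= G u) -> 0 <= signmean G s v.
Proof. by move=> G0; rewrite -(signmean_cst 0 s v); exact: le_signmean. Qed.

Lemma signmean_scale (R : realType) (V : lmodType R) (c : R) (G : V -> R) s v :
  signmean G (map ( *:%R c) s) (c *: v) = signmean (fun u => G (c *: u)) s v.
Proof.
elim: s v => [|z s IH] v //=.
by rewrite -scalerDr -scalerBr !IH.
Qed.


Lemma cvx_mid (R : realType) (V : lmodType R) (G : V -> R) v z :
  cvx G -> G v <= (G (v + z) + G (v - z)) / 2.
Proof.
move=> cG; have h : 0 <= (2^-1 : R) <= 1 by lra.
have := cG _ (v + z) (v - z) h.
have -> : (1 - 2^-1 : R) = 2^-1 by lra.
rewrite -scalerDr addrACA subrr addr0 scalerDr -scalerDl.
rewrite (_ : 2^-1 + 2^-1 = 1); last by lra.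
by rewrite scale1r => /le_trans; apply; lra.
Qed.

Lemma cvx_combD (R : realType) (V : lmodType R) (t : R) (u w e : V) :
  t *: u + (1 - t) *: w + e = t *: (u + e) + (1 - t) *: (w + e).
Proof. by rewrite !scalerDr addrACA -scalerDl subrKC scale1r. Qed.

Lemma signmean_cvx (R : realType) (V : lmodType R) (G : V -> R) s :
  cvx G -> cvx (signmean G s).
Proof.
move=> cG; elim: s => [|z s IH] //= t u w h.
rewrite !cvx_combD; have := IH t (u + z) (w + z) h.
by have := IH t (u - z) (w - z) h; lra.
Qed.

(** Once the signs of [s] are fixed, every extra sign is centred, so Jensen's inequality at a
    midpoint applies. *)
Lemma le_signmean_cat (R : realType) (V : lmodType R) (G : V -> R) s s' v :
  cvx G -> signmean G s v <= signmean G (s ++ s') v.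
Proof.
move=> cG; elim: s v => [|z s IH] v /=; last first.
  by have := IH (v + z); have := IH (v - z); lra.
elim: s' v => [|z s' IH] v //=.
by have := cvx_mid v z cG; have := IH (v + z); have := IH (v - z); lra.
Qed.

Lemma signmean_mid_cvx (R : realType) (V : lmodType R) (G : V -> R) s1 s2 v :
  cvx G -> cvx (fun z => signmean G (s1 ++ z :: s2) v).
Proof.
move=> cG; elim: s1 v => [|y s1 IH] v t u w h /=; last first.
  by have := IH (v + y) t u w h; have := IH (v - y) t u w h; lra.
have cM := signmean_cvx s2 cG.
have := cM t (v + u) (v + w) h; have := cM t (v - u) (v - w) h.
rewrite ![v + _]addrC -!cvx_combD !scalerN -opprD ![_ + v]addrC.
lra.
Qed.

Lemma signmean_midN (R : realType) (V : zmodType) (G : V -> R) s1 s2 v z :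
  signmean G (s1 ++ - z :: s2) v = signmean G (s1 ++ z :: s2) v.
Proof.
elim: s1 v => [|y s1 IH] v /=; last by rewrite !IH.
by rewrite opprK addrC.
Qed.

Lemma cvx_exp2 (R : realType) (V : lmodType R) (G : V -> R) :
  (forall u, 0 <= G u) -> cvx G -> cvx (fun u => G u ^+ 2).
Proof.
move=> G0 cG t u w h; have := cG t u w h.
have := G0 (t *: u + (1 - t) *: w); have := G0 u; have := G0 w.
move: (G _) (G u) (G w) => a b c c0 b0 a0 abc.
apply: (@le_trans _ _ ((t * b + (1 - t) * c) ^+ 2)).
  by rewrite ler_sqr ?nnegrE// (le_trans a0).
have : 0 <= t * (1 - t) * (b - c) ^+ 2.
  by rewrite mulr_ge0 ?sqr_ge0// mulr_ge0//; lra.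
lra.
Qed.

(** Minkowski's inequality in disguise: the square root of [phi], an L_2 norm over the signs, is
    convex in the base point. The induction adds one sign and needs only Cauchy-Schwarz in the
    plane. *)
Lemma signmean_sqr_cvx (R : realType) (V : lmodType R) (G : V -> R) s
    (phi := signmean (fun v => G v ^+ 2) s) t u w :
  (forall u, 0 <= G u) -> cvx G -> 0 <= t <= 1 ->
  phi (t *: u + (1 - t) *: w) <=
    (t * Num.sqrt (phi u) + (1 - t) * Num.sqrt (phi w)) ^+ 2.
Proof.
rewrite /phi => G0 cG h; elim: s u w {phi} => [|z s IH] u w /=.
  rewrite !sqrtr_sqr !ger0_norm// ler_sqr ?nnegrE//; first exact: cG.
  by rewrite addr_ge0// mulr_ge0//; lra.
move: IH; set phi := signmean _ _ => IH.
have phi0 v : 0 <= phi v by apply: signmean_ge0 => y; rewrite sqr_ge0.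
rewrite !cvx_combD.
have := IH (u + z) (w + z); have := IH (u - z) (w - z).
have := sqr_sqrtr (phi0 (u + z)); have := sqr_sqrtr (phi0 (u - z)).
have := sqr_sqrtr (phi0 (w + z)); have := sqr_sqrtr (phi0 (w - z)).
have := sqrtr_ge0 (phi (u + z)); have := sqrtr_ge0 (phi (u - z)).
have := sqrtr_ge0 (phi (w + z)); have := sqrtr_ge0 (phi (w - z)).
move: (phi (_ *: _ + _)) (phi (_ *: _ + _)) (Num.sqrt (phi _)) (Num.sqrt (phi _))
  (Num.sqrt (phi _)) (Num.sqrt (phi _)) => p1 p2 a b c d.
move: (phi (w - z)) (phi (w + z)) (phi (u - z)) (phi (u + z)).
move=> _ _ _ _ a0 b0 c0 d0 <- <- <- <- h1 h2.
set A := (a ^+ 2 + b ^+ 2) / 2; set B := (c ^+ 2 + d ^+ 2) / 2.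
have A0 : 0 <= A by rewrite divr_ge0// addr_ge0 ?sqr_ge0.
have B0 : 0 <= B by rewrite divr_ge0// addr_ge0 ?sqr_ge0.
have CS : (a * c + b * d) / 2 <= Num.sqrt A * Num.sqrt B.
  have := sqrtr_ge0 A; have := sqrtr_ge0 B => sB sA.
  rewrite -ler_sqr ?nnegrE ?mulr_ge0// ?addr_ge0 ?mulr_ge0//.
  rewrite [leRHS]exprMn !sqr_sqrtr// /A /B.
  have := sqr_ge0 (a * d - b * c); lra.
have := sqr_sqrtr A0; have := sqr_sqrtr B0.
move: (Num.sqrt A) (Num.sqrt B) CS => sA sB CS eB eA.
have : 0 <= t * (1 - t) by rewrite mulr_ge0//; lra.
move=> tt; have := ler_wpM2l tt CS.
rewrite /A /B in eA eB.
have eA' := congr1 ( *%R (t ^+ 2)) eA.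
have eB' := congr1 ( *%R ((1 - t) ^+ 2)) eB.
lra.
Qed.

(* Two-point inequality (constant [1/sqrt 3] for the exponents 2 and 4),
   tensorised one sign at a time. *)
Lemma signmean_hyper (R : realType) (V : lmodType R) (G : V -> R) (r : R) s v :
  (forall u, 0 <= G u) -> cvx G -> 0 <= r -> r ^+ 2 = 3^-1 ->
  signmean (fun u => G u ^+ 4) (map ( *:%R r) s) v <=
    (signmean (fun u => G u ^+ 2) s v) ^+ 2.
Proof.
move=> G0 cG r0 r3; elim: s v => [|z s IH] v /=; first by rewrite -exprM.
have r1 : r <= 1 by rewrite -ler_sqr ?nnegrE// r3; lra.
(* The points [v + r *: z] and [v - r *: z] are the convex combinations of [v + z] and [v - z] with
   weights [(1 + r) / 2] and [(1 - r) / 2]. By convexity of the L_2 norm the problem becomes one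
   about the two numbers [a] and [b]. *)
have h : 0 <= (1 + r) / 2 <= 1 by lra.
have h' : 0 <= (1 - r) / 2 <= 1 by lra.
have := IH (v + r *: z); have := IH (v - r *: z).
have := signmean_sqr_cvx s (v + z) (v - z) G0 cG h.
have := signmean_sqr_cvx s (v + z) (v - z) G0 cG h'.
have E e : (e *: (v + z) + (1 - e) *: (v - z)) = v + (2 * e - 1) *: z.
  rewrite !scalerDr addrACA -scalerDl subrKC scale1r scalerN -scalerBl.
  by congr (_ + _ *: _); lra.
rewrite /= !E.
rewrite (_ : 2 * _ - 1 = - r); last lra.
rewrite (_ : 2 * _ - 1 = r); last lra.
rewrite scaleNr.
set phi := signmean (fun v => G v ^+ 2) s.
have phi0 u : 0 <= phi u by apply: signmean_ge0 => y; rewrite sqr_ge0.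
have := phi0 (v + r *: z); have := phi0 (v - r *: z).
have := sqr_sqrtr (phi0 (v + z)); have := sqr_sqrtr (phi0 (v - z)).
have := sqrtr_ge0 (phi (v + z)); have := sqrtr_ge0 (phi (v - z)).
move: (phi (_ + _ *: _)) (phi (_ - _ *: _)) => p q.
move: (Num.sqrt (phi _)) (Num.sqrt (phi _)) => a b.
move: (phi (v - z)) (phi (v + z)) => _ _ a0 b0 <- <- q0 p0.
set P := (X in q <= X ^+ 2); set Q := (X in p <= X ^+ 2) => hq hp.
have {}hq : q ^+ 2 <= (P ^+ 2) ^+ 2 by rewrite ler_sqr ?nnegrE ?sqr_ge0.
have {}hp : p ^+ 2 <= (Q ^+ 2) ^+ 2 by rewrite ler_sqr ?nnegrE ?sqr_ge0.
move=> h3 h4.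
suff : ((Q ^+ 2) ^+ 2 + (P ^+ 2) ^+ 2) / 2 <= ((a ^+ 2 + b ^+ 2) / 2) ^+ 2 by lra.
set A := (a + b) / 2; set B := (a - b) / 2.
have -> : Q = A + r * B by rewrite /A /B /Q; lra.
have -> : P = A - r * B by rewrite /A /B /P; lra.
have -> : ((a ^+ 2 + b ^+ 2) / 2) = A ^+ 2 + B ^+ 2 by rewrite /A /B; lra.
have -> : (((A + r * B) ^+ 2) ^+ 2 + ((A - r * B) ^+ 2) ^+ 2) / 2 =
  A ^+ 4 + 6 * r ^+ 2 * A ^+ 2 * B ^+ 2 + (r ^+ 2) ^+ 2 * B ^+ 4 by lra.
(* This fixes the constant: the cross term [6 * r ^+ 2] must not exceed the 2 in the expansion of
   [(A ^+ 2 + B ^+ 2) ^+ 2], and [r ^+ 2 = 3^-1] gives exactly 2. *)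
rewrite r3; have : 0 <= (B ^+ 2) ^+ 2 by exact: sqr_ge0.
lra.
Qed.

Lemma norm_cvx (R : realType) (E : normedModType R) : cvx (fun u : E => `|u|).
Proof.
move=> t u w /andP[t0 t1]; apply: (le_trans (ler_normD _ _)).
by rewrite !normrZ !ger0_norm// subr_ge0.
Qed.

Lemma norm_exp_cvx (R : realType) (E : normedModType R) j :
  cvx (fun u : E => `|u| ^+ (2 ^ j)).
Proof.
elim: j => [|j IH]; first exact: norm_cvx.
rewrite (_ : (fun _ => _) = (fun u : E => (`|u| ^+ (2 ^ j)) ^+ 2)).
  by apply: cvx_exp2 => // u; rewrite exprn_ge0.
by apply/funext => u; rewrite -exprM expnSr.
Qed.

(** The exponent doubles at each step: [signmean_hyper] is applied to the convex function
    [|u| ^+ (2 ^ j)], and homogeneity undoes the contraction by [r] at the price of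
    [r ^+ (2 ^ j.+2)]. The constant does not depend on the number of vectors. *)
Lemma kahane (R : realType) (E : normedModType R) j :
  exists2 K : R, 0 <= K & forall s : seq E,
    signmean (fun u => `|u| ^+ (2 ^ j.+1)) s 0 <=
      K * signmean (fun u => `|u| ^+ 2) s 0 ^+ (2 ^ j).
Proof.
elim: j => [|j [K K0 IH]]; first by exists 1 => // s; rewrite mul1r.
set r : R := Num.sqrt 3^-1.
have r3 : r ^+ 2 = 3^-1 by rewrite sqr_sqrtr.
have r0 : 0 < r by rewrite sqrtr_gt0.
have rq0 : 0 < r ^+ (2 ^ j.+2) by rewrite exprn_gt0.
exists (K ^+ 2 / r ^+ (2 ^ j.+2)).
  by rewrite divr_ge0 ?exprn_ge0// ltW.
move=> s.
have G0 (u : E) : 0 <= `|u| ^+ (2 ^ j) by rewrite exprn_ge0.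
have := signmean_hyper s 0 G0 (@norm_exp_cvx R E j) (ltW r0) r3.
rewrite -(scaler0 _ r) signmean_scale scaler0.
have -> : (fun u : E => (`|r *: u| ^+ (2 ^ j)) ^+ 4) =
    (fun u => r ^+ (2 ^ j.+2) * `|u| ^+ (2 ^ j.+2)).
  apply/funext => u; rewrite -exprM normrZ gtr0_norm//.
  by rewrite (_ : (_ * 4)%N = (2 ^ j.+2)%N) ?exprMn// !expnS mulnA mulnC.
rewrite signmeanM -ler_pdivlMl// => /le_trans; apply.
rewrite mulrC -mulrA [X in _ <= _ * X]mulrC mulrA ler_pM2r ?invr_gt0//.
have -> : (fun u : E => (`|u| ^+ (2 ^ j)) ^+ 2) = (fun u => `|u| ^+ (2 ^ j.+1)).
  by apply/funext => u; rewrite -exprM expnSr.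
rewrite [X in _ * _ ^+ X]expnSr exprM -exprMn ler_sqr//.
  by rewrite nnegrE signmean_ge0// => u; rewrite exprn_ge0.
by rewrite nnegrE mulr_ge0// exprn_ge0// signmean_ge0// => u; rewrite exprn_ge0.
Qed.

(** * Removing the weights *)

(* The segment [y, x] is cut into [m ~ 1 / |lam|] pieces: [(f x - f y) / m] is
   the mean of the increments of [f] over the pieces. *)
Lemma increment_hull (R : realType) (X E : normedModType R) (f : X -> E)
    (K : E -> Prop) (d lam : R) (x y : X) :
  (forall t u w, 0 <= t <= 1 -> K u -> K w -> K (t *: u + (1 - t) *: w)) ->
  (forall u, K u -> K (- u)) ->
  (forall u w, `|u - w| <= d -> K (f u - f w)) ->
  `|lam| < 1 -> `|x - y| * (`|lam| / (1 - `|lam|)) <= d ->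
  K (lam *: (f x - f y)).
Proof.
move=> Kcvx KN Kf lam1 xyd.
have l1 : 0 < 1 - `|lam| by rewrite subr_gt0.
have d0 : 0 <= d by rewrite (le_trans _ xyd)// !mulr_ge0// invr_ge0 ltW.
have K0 : K 0 by rewrite -(subrr (f x)); apply: Kf; rewrite subrr normr0.
have Kscale c u : `|c| <= 1 -> K u -> K (c *: u).
  move=> c1 Ku; have Kpos e : 0 <= e <= 1 -> K (e *: u).
    by move=> he; rewrite -[_ *: _]addr0 -(scaler0 _ (1 - e)); exact: Kcvx.
  have [c0|c0] := leP 0 c; first by apply: Kpos; rewrite c0 -(ger0_norm c0).
  rewrite -[c]opprK scaleNr; apply: KN; apply: Kpos.
  by rewrite -(ltr0_norm c0) c1 normr_ge0.
have [->|lam0] := eqVneq lam 0; first by rewrite scale0r.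
have nl0 : 0 < `|lam| by rewrite normr_gt0.
(* With [m] the integer part of [1 / |lam|], both roundings go the right way: [|lam| * m <= 1], so
   the final rescaling stays in the balanced set [K], and [m] is at least [1 / |lam| - 1], so a
   piece of length [|x - y| / m] is at most [d]. *)
pose m := Num.truncn `|lam|^-1.
have /andP[m1 m2] : m%:R <= `|lam|^-1 < m.+1%:R.
  by apply: truncn_itv; rewrite invr_ge0.
have m0 : 0 < m%:R :> R.
  rewrite ltr0n; case: m m2 {m1} => //; rewrite invf_plt ?posrE// invr1.
  by rewrite ltNge ltW.
have mlam : (1 - `|lam|) / `|lam| <= m%:R.
  by rewrite mulrBl divff ?normr_eq0// mul1r lerBlDr -natr1 in m2 *; exact: ltW.
pose u (j : nat) := y + (j%:R / m%:R) *: (x - y).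
have du j : `|u j.+1 - u j| <= d.
  rewrite /u opprD addrACA subrr add0r -scalerBl -mulrBl -natr1 addrAC subrr.
  rewrite add0r mul1r normrZ gtr0_norm ?invr_gt0//.
  apply: le_trans xyd; rewrite mulrC ler_wpM2l// -invf_div lef_pV2 ?posrE//.
  by rewrite divr_gt0.
(* Running means: the mean of [k.+1] increments is the combination, with weights [k / k.+1] and
   [1 / k.+1], of the mean of the first [k] and the last one. At [k = 0] the convention [0^-1 = 0]
   makes the claim [K 0]. *)
have Kmean k : K (k%:R^-1 *: (f (u k) - f (u 0%N))).
  elim: k => [|k IH]; first by rewrite invr0 scale0r.
  have := Kcvx (k%:R / k.+1%:R) _ (f (u k.+1) - f (u k)) _ IH (Kf _ _ (du k)).
  have [->|k0] := eqVneq k 0%N.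
    rewrite mul0r scale0r add0r subr0 scale1r invr1 scale1r; apply.
    by rewrite lexx ler01.
  have -> : 1 - k%:R / k.+1%:R = k.+1%:R^-1 :> R.
    by rewrite -[X in X - _](@divff _ k.+1%:R)// -mulrBl -natr1 addrAC subrr add0r mul1r.
  rewrite scalerA mulrAC divff ?pnatr_eq0// mul1r -scalerDr addrC subrKA.
  by apply; rewrite divr_ge0//= ler_pdivrMr ?ltr0n// mul1r ler_nat.
have := Kmean m.
rewrite {1}/u /u divff ?gt_eqF// scale1r subrKC mul0r scale0r addr0.
have -> : lam = (lam * m%:R) * m%:R^-1 by rewrite mulfK// gt_eqF.
rewrite -scalerA; apply: Kscale.
by rewrite normrM (gtr0_norm m0) -ler_pdivlMl// mulr1.
Qed.

Lemma mkseq_cat (T : Type) (a : nat -> T) k N : (k < N)%N ->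
  mkseq a N = mkseq a k ++ a k :: mkseq (fun i => a (k.+1 + i)%N) (N - k.+1).
Proof.
move=> kN; rewrite /mkseq -{1}(subnKC kN) addSnnS iotaD map_cat /= add0n.
by congr (_ ++ _ :: _); rewrite -[X in iota X]addn0 iotaDl -map_comp.
Qed.

(** The second hypothesis says that [z i] lies in the symmetric convex hull of [A i], phrased as
    membership in every symmetric convex set containing [A i]. With the other slots frozen, the
    vectors keeping the mean below [B] form such a set, so the slots can be changed from [A i] to
    [z i] one after another. *)
Lemma signmean_replace (R : realType) (E : normedModType R) (G : E -> R)
    (A : nat -> set E) (z : nat -> E) (B : R) (N : nat) :
  cvx G ->
  (forall i (K : set E), (i < N)%N ->
     (forall t u w, 0 <= t <= 1 -> K u -> K w -> K (t *: u + (1 - t) *: w)) ->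
     (forall u, K u -> K (- u)) -> A i `<=` K -> K (z i)) ->
  (forall a, (forall i, (i < N)%N -> A i (a i)) ->
     signmean G (mkseq a N) 0 <= B) ->
  signmean G (mkseq z N) 0 <= B.
Proof.
move=> cG Az AB.
have H k : forall a, (forall i, (i < k)%N -> a i = z i) ->
    (forall i, (k <= i < N)%N -> A i (a i)) -> signmean G (mkseq a N) 0 <= B.
  elim: k => [|k IH] a a1 a2; first by apply: AB => i; exact: a2.
  have [Nk|kN] := leqP N k.
    apply: IH => i; first by move=> ik; apply: a1; exact: ltnW.
    by move=> /andP[ki iN]; have := leq_trans iN Nk; rewrite ltnNge ki.
  pose s1 := mkseq a k; pose s2 := mkseq (fun i => a (k.+1 + i)%N) (N - k.+1).
  rewrite (mkseq_cat _ kN) a1//.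
  apply: (Az k [set w | signmean G (s1 ++ w :: s2) 0 <= B]) => //=.
  - move=> t u w h hu hw; apply: le_trans (signmean_mid_cvx _ _ _ cG _ _ h) _.
    have /andP[t0 t1] := h.
    have t1' : 0 <= 1 - t by rewrite subr_ge0.
    by have := ler_wpM2l t0 hu; have := ler_wpM2l t1' hw; lra.
  - by move=> u; rewrite signmean_midN.
  - move=> w Aw /=; pose a' i := if i == k then w else a i.
    have a'k : a' k = w by rewrite /a' eqxx.
    have := IH a'; rewrite (mkseq_cat _ kN) a'k.
    have -> : mkseq a' k = s1.
      apply/eq_in_map => i; rewrite mem_iota add0n => /andP[_ ik].
      by rewrite /a' ltn_eqF.
    have -> : mkseq (fun i => a' (k.+1 + i)%N) (N - k.+1) = s2.
      by apply: eq_map => i; rewrite /a' gtn_eqF// addSn ltnS leq_addr.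
    apply=> i ik; rewrite /a'; first by rewrite ltn_eqF// a1// ltnW.
    case: eqP => [->//|/eqP nik]; apply: a2.
    by move: ik => /andP[ki ->]; rewrite andbT ltn_neqAle eq_sym nik.
by apply: (H N) => // i /andP[Ni]; rewrite ltnNge Ni.
Qed.

Lemma type_of_unweighted (R : realType) (X E : normedModType R) (f : X -> E)
    (p L : R) (N : nat) (lam : nat -> R) (x y : nat -> X) :
  0 < p -> 0 <= L ->
  (forall u w : nat -> X,
    Num.sqrt (signmean (fun v => `|v| ^+ 2)
      (mkseq (fun i => f (u i) - f (w i)) N) 0) <=
    L * (\sum_(i < N) `|u i - w i| `^ p) `^ p^-1) ->
  Num.sqrt (signmean (fun v => `|v| ^+ 2)
      (mkseq (fun i => lam i *: (f (x i) - f (y i))) N) 0) <=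
    L * (\sum_(i < N) `|lam i| `^ p * `|x i - y i| `^ p) `^ p^-1.
Proof.
move=> p0 L0 H.
pose z i := lam i *: (f (x i) - f (y i)).
set S := (\sum_(i < N) _) `^ _.
have S0 : 0 <= S by exact: powR_ge0.
pose Lam := 1 + \sum_(i < N) `|lam i|.
have Lam0 : 0 < Lam by rewrite ltr_pwDl// sumr_ge0.
have lamLam i : (i < N)%N -> `|lam i| <= Lam.
  move=> iN; rewrite /Lam (bigD1 (Ordinal iN))//= addrCA lerDl.
  by rewrite addr_ge0// sumr_ge0.
have sqcvx : cvx (fun v : E => `|v| ^+ 2).
  by apply: cvx_exp2 => // ; exact: norm_cvx.
(* Scaling all weights by [c = e / Lam] brings them below [e]. Then [1 - |c * lam i|] is at least
   [1 - e], so increments at distance at most [d i] suffice for [increment_hull], and dividing by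
   [c] afterwards leaves only the factor [1 / (1 - e)]. *)
have main e : 0 < e < 1 ->
    Num.sqrt (signmean (fun v => `|v| ^+ 2) (mkseq z N) 0) <= L * S / (1 - e).
  move=> /andP[e0 e1].
  have e1' : 0 < 1 - e by rewrite subr_gt0.
  pose c := e / Lam; have c0 : 0 < c by rewrite divr_gt0.
  have clam i : (i < N)%N -> `|c * lam i| <= e.
    move=> iN; rewrite normrM gtr0_norm// /c mulrAC ler_pdivrMr//.
    by rewrite ler_pM2l// lamLam.
  pose d i := `|x i - y i| * (`|c * lam i| / (1 - e)).
  have d0 i : 0 <= d i by rewrite !mulr_ge0// invr_ge0 ltW.
  have C0 : 0 <= c / (1 - e) by apply: divr_ge0; exact: ltW.
  have dS : (\sum_(i < N) d i `^ p) `^ p^-1 = c / (1 - e) * S.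
    have CE : c / (1 - e) = ((c / (1 - e)) `^ p) `^ p^-1.
      by rewrite -powRrM mulfV ?gt_eqF// powRr1.
    rewrite /S [in RHS]CE -powRM ?powR_ge0//; last first.
      by apply: sumr_ge0 => i _; rewrite mulr_ge0// powR_ge0.
    congr (_ `^ _); rewrite mulr_sumr; apply: eq_bigr => i _.
    rewrite -!powRM ?C0// ?mulr_ge0//.
    congr (_ `^ _); rewrite /d normrM (gtr0_norm c0).
    by rewrite [LHS]mulrC -!mulrA (mulrCA `|lam i|).
  suff : signmean (fun v => `|v| ^+ 2) (mkseq (fun i => c *: z i) N) 0 <=
      (L * (c / (1 - e) * S)) ^+ 2.
    have -> : mkseq (fun i => c *: z i) N = map ( *:%R c) (mkseq z N).
      by rewrite -map_comp.
    have := signmean_scale c (fun v => `|v| ^+ 2) (mkseq z N) 0.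
    rewrite scaler0 => ->.
    rewrite (_ : (fun u : E => _) = (fun u : E => c ^+ 2 * `|u| ^+ 2)); last first.
      by apply/funext => u; rewrite normrZ gtr0_norm// exprMn.
    rewrite signmeanM -(ler_sqrt _ (sqr_ge0 _)) sqrtrM ?sqr_ge0//.
    rewrite !sqrtr_sqr (gtr0_norm c0) ger0_norm; last first.
      by rewrite mulr_ge0// (mulr_ge0 C0).
    rewrite -ler_pdivlMl// => /le_trans; apply.
    by rewrite le_eqVlt; apply/orP; left; apply/eqP; field; rewrite !gt_eqF.
  apply: (@signmean_replace _ _ _
    (fun i => [set v | exists u w, `|u - w| <= d i /\ v = f u - f w])) => //.
    move=> i K iN Kc KN AK.
    rewrite /z scalerA; apply: (@increment_hull _ _ _ f K (d i)) => //.
    - by move=> u w uw; apply: AK; exists u, w.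
    - by rewrite (le_lt_trans (clam i iN)).
    - rewrite /d ler_wpM2l// ler_wpM2l// lef_pV2 ?posrE//.
      + by rewrite lerD2l lerN2 clam.
      + by rewrite subr_gt0 (le_lt_trans (clam i iN)).
  move=> a Aa.
  have /choice[uw uwE] : forall i, exists uw : X * X, (i < N)%N ->
      `|uw.1 - uw.2| <= d i /\ a i = f uw.1 - f uw.2.
    move=> i; have [iN|_] := ltnP i N; last by exists (0, 0).
    by have [u [w [? ?]]] := Aa i iN; exists (u, w).
  have := H (fun i => (uw i).1) (fun i => (uw i).2).
  rewrite (_ : mkseq (fun i => f _ - f _) N = mkseq a N); last first.
    apply/eq_in_map => i; rewrite mem_iota add0n => /andP[_ iN].
    by rewrite (uwE i iN).2.
  set Psi := signmean _ _ _ => h.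
  have Psi0 : 0 <= Psi by apply: signmean_ge0 => v; rewrite exprn_ge0.
  rewrite -(sqr_sqrtr Psi0) ler_sqr ?nnegrE ?sqrtr_ge0//; last first.
    by rewrite mulr_ge0// (mulr_ge0 C0).
  apply: (le_trans h); rewrite -dS ler_wpM2l// ge0_ler_powR ?nnegrE//.
  - by rewrite invr_ge0 ltW.
  - by apply: sumr_ge0 => i _; exact: powR_ge0.
  - by apply: sumr_ge0 => i _; exact: powR_ge0.
  - apply: ler_sum => i _; rewrite ge0_ler_powR ?nnegrE//; first exact: ltW.
    exact: (uwE i (ltn_ord i)).1.
have LS0 : 0 <= L * S by rewrite mulr_ge0.
rewrite leNgt; apply/negP; set Q := Num.sqrt _ => LSQ.
have Q0 : 0 < Q by exact: le_lt_trans LSQ.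
(* Chosen so that [L * S = Q * (1 - 2 * e)], which contradicts the bound [Q * (1 - e) <= L * S]
   given by [main]. *)
pose e := (1 - L * S / Q) / 2.
have LSQ1 : L * S / Q < 1 by rewrite ltr_pdivrMr// mul1r.
have LSQ0 : 0 <= L * S / Q by rewrite divr_ge0// ltW.
have e01 : 0 < e < 1 by rewrite /e; lra.
have := main e e01; rewrite -/Q ler_pdivlMr; last by lra.
have -> : L * S = Q * (1 - 2 * e).
  by rewrite /e; field; rewrite gt_eqF.
by rewrite ler_pM2l//; lra.
Qed.

(** * Integrals of Rademacher sums *)

(** The condition of [simple_fun] with an arbitrary target type. It is stable under pairing and
    under composition with any map whatsoever, so no sigma-algebra on [E] is needed to combine such
    functions. *)
Definition finitary (R : realType) (T : Type) (h : R -> T) : Prop :=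
  finite_set (range h) /\ forall v, measurable (h @^-1` [set v]).

Lemma finitary_preimage (R : realType) (T : Type) (h : R -> T) (B : set T) :
  finitary h -> measurable (h @^-1` B).
Proof.
move=> [hfin hm].
have -> : h @^-1` B = \bigcup_(v in range h `&` B) (h @^-1` [set v]).
  apply/seteqP; split => [t Bt|t [v [_ Bv] /= ->]//].
  by exists (h t) => //; split => //; exists t.
by apply: fin_bigcup_measurable => //; exact: finite_setIl.
Qed.

Lemma finitary_comp (R : realType) (T U : Type) (h : R -> T) (g : T -> U) :
  finitary h -> finitary (g \o h).
Proof.
move=> hh; split; last by move=> v; exact: (finitary_preimage (g @^-1` [set v]) hh).
by have := finite_image g hh.1; rewrite image_comp.
Qed.

Lemma finitary_pair (R : realType) (T U : Type) (h : R -> T) (g : R -> U) :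
  finitary h -> finitary g -> finitary (fun t => (h t, g t)).
Proof.
move=> hh hg; split => [|[v w]].
  exact: (finite_image11 pair hh.1 hg.1).
have -> : (fun t => (h t, g t)) @^-1` [set (v, w)] =
    h @^-1` [set v] `&` g @^-1` [set w].
  by apply/seteqP; split => [t /= [-> ->]//|t /= [-> ->]].
by apply: measurableI; [exact: hh.2|exact: hg.2].
Qed.

Lemma finitary_comp2 (R : realType) (T U V : Type) (op : T -> U -> V)
    (h : R -> T) (g : R -> U) :
  finitary h -> finitary g -> finitary (fun t => op (h t) (g t)).
Proof.
move=> hh hg.
exact: (finitary_comp (fun q => op q.1 q.2) (finitary_pair hh hg)).
Qed.

Lemma finitary_cst (R : realType) (T : Type) (c : T) :
  finitary (fun _ : R => c).
Proof.
split; first exact: finite_image_cst.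
move=> v; have [<-|cv] := pselect (c = v).
  by rewrite (_ : _ @^-1` _ = setT) //; apply/seteqP; split.
by rewrite (_ : _ @^-1` _ = set0) //; apply/seteqP; split.
Qed.

Lemma measurable_finitary (R : realType) (T : Type) (D : set R) (h : R -> T)
    (G : T -> R) :
  finitary h -> measurable_fun D (fun t => G (h t)).
Proof.
move=> hh mD B mB; apply: measurableI => //.
exact: (finitary_preimage (G @^-1` B) hh).
Qed.

Lemma finitary_rademacher (R : realType) n : finitary (@rademacher R n).
Proof.
split.
  apply: (@sub_finite_set _ _ [set -1; 0; 1]) => //.
  move=> _ [t _ <-]; rewrite /rademacher.
  by case: sgrP => _ /=; [left; right|right|left; left].
move=> v; rewrite -[X in measurable X]setTI.
suff mr : measurable_fun setT (@rademacher R n).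
  exact: (mr measurableT _ (measurable_set1 v)).
apply: (measurableT_comp (f := @Num.sg R)
  (g := fun t => sin (2 ^+ n.+1 * pi * t))).
  apply: nondecreasing_measurable => // x y xy.
  by have := xy; case: (sgrP x); case: (sgrP y) => //; lra.
apply: continuous_measurable_fun => t; apply: continuous_comp.
  exact: mulrl_continuous.
exact: continuous_sin.
Qed.

Lemma finitary_rad_sum (R : realType) (E : normedModType R) (v : E)
    (x : nat -> E) m n :
  finitary (fun t : R => v + \sum_(i < n) rademacher (m + i) t *: x i).
Proof.
elim: n => [|n IH].
  have := finitary_cst R v; congr finitary; apply/funext => t.
  by rewrite big_ord0 addr0.
have := finitary_comp2 (fun (u : E) r => u + r *: x n) IH
  (finitary_rademacher R (m + n)).
congr finitary; apply/funext => t.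
by rewrite big_ord_recr/= addrA.
Qed.

Lemma sinDpin (R : realType) (k : nat) (t : R) :
  sin (t + k%:R * pi) = (-1) ^+ k * sin t.
Proof.
elim: k => [|k IH]; first by rewrite mul0r addr0 mul1r.
by rewrite -natr1 mulrDl mul1r addrA sinDpi IH exprS mulN1r mulNr.
Qed.

Lemma rademacher_dyadic (R : realType) (n k : nat) (t : R) :
  k%:R / 2 ^+ n.+1 < t < k.+1%:R / 2 ^+ n.+1 -> rademacher n t = (-1) ^+ k.
Proof.
have n0 : 0 < 2 ^+ n.+1 :> R by rewrite exprn_gt0.
rewrite ltr_pdivrMr// ltr_pdivlMr// -natr1 => /andP[h1 h2].
(* Removing [k] half-periods puts the argument of the sine strictly between 0 and [pi]. The dyadic
   endpoints, where the sine vanishes, are excluded. *)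
have -> : rademacher n t = Num.sg (sin ((2 ^+ n.+1 * t - k%:R) * pi + k%:R * pi)).
  by rewrite /rademacher -mulrDl subrK mulrAC.
rewrite sinDpin sgrM sgrX sgrN sgr1 gtr0_sg ?mulr1//.
apply: sin_gt0_pi; rewrite mulr_gt0 ?pi_gt0//=; last lra.
by rewrite gtr_pMl ?pi_gt0//; lra.
Qed.

(** Independence of the Rademacher functions by bisection: on a dyadic interval of length [2 ^- m],
    [rademacher m] is 1 on the left half and -1 on the right half, and the later ones restrict to
    the same situation on each half. The level [m], the position [k] and the base point [v] all vary
    in the induction. *)
Lemma integral_dyadic (R : realType) (E : normedModType R) (G : E -> R)
    (s : seq E) (m k : nat) (v : E) :
  (forall u, 0 <= G u) ->
  (\int[@lebesgue_measure R]_(t in `](k%:R / 2 ^+ m)%R, (k.+1%:R / 2 ^+ m)%R[)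
    (G (v + \sum_(i < size s) rademacher (m + i) t *: s`_i)%R)%:E =
  (signmean G s v / 2 ^+ m)%R%:E)%E.
Proof.
move=> G0; elim: s m k v => [|z s IH] m k v /=.
  rewrite (eq_integral (cst (G v)%:E)); last first.
    by move=> t _; rewrite big_ord0 addr0.
  rewrite integral_cst//= lebesgue_measure_itv/= lte_fin.
  rewrite ltr_pM2r ?invr_gt0 ?exprn_gt0// ltr_nat leqnn -EFinB -EFinM.
  by rewrite -mulrBl -natr1 addrAC subrr add0r mul1r.
have p0 j : 0 < 2 ^+ j :> R by rewrite exprn_gt0.
set a : R := k%:R / 2 ^+ m; set b : R := k.+1%:R / 2 ^+ m.
pose c : R := (k.*2).+1%:R / 2 ^+ m.+1.
have aE : a = k.*2%:R / 2 ^+ m.+1.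
  by rewrite /a exprS -muln2 natrM; field; rewrite gt_eqF.
have bE : b = (k.*2).+2%:R / 2 ^+ m.+1.
  by rewrite /b exprS -doubleS -muln2 natrM; field; rewrite gt_eqF.
have ac : a < c by rewrite aE ltr_pM2r ?invr_gt0// ltr_nat.
have cb : c < b by rewrite bE ltr_pM2r ?invr_gt0// ltr_nat.
have fin := finitary_rad_sum v (nth 0 (z :: s)) m (size s).+1.
have mF (D : set R) : measurable_fun D (EFin \o (fun t => G (v +
    \sum_(i < (size s).+1) rademacher (m + i) t *: (z :: s)`_i))).
  by apply/measurable_EFinP; exact: (measurable_finitary G fin).
rewrite (_ : [set` `]a, b[] = [set` `]a, c]] `|` [set` `]c, b[]); last first.
  rewrite (@itv_bndbnd_setU _ _ _ (BRight c))// ?bnd_simp//; exact: ltW.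
rewrite ge0_integral_setU//=; last 3 first.
- exact: mF.
- by move=> t _; rewrite lee_fin.
- apply/disj_setPS => t /= [].
  by rewrite !in_itv/= => /andP[_ h1] /andP[h2 _]; move: (le_lt_trans h1 h2); rewrite ltxx.
rewrite -integral_itv_bndo_bndc; last exact: mF.
rewrite [X in (X + _)%E = _](_ : _ = (signmean G s (v + z) / 2 ^+ m.+1)%:E); last first.
  rewrite -(IH m.+1 k.*2) -aE -/c; apply: eq_integral => t; rewrite inE/= in_itv/= => tac.
  rewrite big_ord_recl/= addn0 (@rademacher_dyadic _ _ k.*2); last by rewrite -aE.
  rewrite -signr_odd odd_double scale1r addrA; congr (G (_ + _))%:E.
  by apply: eq_bigr => i _; rewrite addSnnS.
rewrite [X in (_ + X)%E = _](_ : _ = (signmean G s (v - z) / 2 ^+ m.+1)%:E); last first.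
  rewrite -(IH m.+1 (k.*2).+1) -bE -/c; apply: eq_integral => t; rewrite inE/= in_itv/= => tac.
  rewrite big_ord_recl/= addn0 (@rademacher_dyadic _ _ (k.*2).+1); last by rewrite -bE.
  rewrite -signr_odd /= odd_double scaleN1r addrA; congr (G (_ + _))%:E.
  by apply: eq_bigr => i _; rewrite addSnnS.
rewrite -EFinD; congr EFin; rewrite exprS; field.
by rewrite gt_eqF.
Qed.

Lemma rad_partialE (R : realType) (E : normedModType R) (x : nat -> E) N t :
  rad_partial x N t = 0 + \sum_(i < N) rademacher (0 + i) t *: x i.
Proof. by rewrite add0r. Qed.

Lemma finitary_rad_partial (R : realType) (E : normedModType R) (x : nat -> E) N :
  finitary (rad_partial x N).
Proof.
have := finitary_rad_sum 0 x 0 N; congr finitary; apply/funext => t.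
by rewrite rad_partialE.
Qed.

Lemma int01_rad (R : realType) (E : normedModType R) (G : E -> R)
    (x : nat -> E) N :
  (forall u, 0 <= G u) ->
  int01 (fun t => G (rad_partial x N t)) = (signmean G (mkseq x N) 0)%:E.
Proof.
move=> G0; have := @integral_dyadic R E G (mkseq x N) 0 0 0 G0.
rewrite expr0 !divr1 => <-; rewrite /int01 integral_itv_bndoo; last first.
  by apply/measurable_EFinP; apply: (measurable_finitary G); exact: finitary_rad_partial.
apply: eq_integral => t _; rewrite rad_partialE size_mkseq.
by congr (G (_ + _))%:E; apply: eq_bigr => i _; rewrite nth_mkseq.
Qed.

(** * The norms of Rad and RAD *)

Lemma cvg_ereal0P (R : realType) (u : (\bar R)^nat) :
  (forall n, (0 <= u n)%E) ->
  (u n @[n --> \oo] --> 0%E) <->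
  (forall e : R, 0 < e -> exists n0, forall n, (n0 <= n)%N -> (u n <= e%:E)%E).
Proof.
move=> u0; split => [/fine_cvgP[ufin]|H].
  move=> /cvgr0Pnorm_le ufine e /ufine ue.
  have [n0 _ Hn0] := filterI ufin ue.
  exists n0 => n /Hn0 [un]; rewrite /= ger0_norm ?fine_ge0// => h.
  by rewrite -(fineK un) lee_fin.
apply/fine_cvgP; split.
  have [n0 Hn0] := H 1 ltr01; exists n0 => // n /Hn0 un.
  by rewrite ge0_fin_numE// (le_lt_trans un)// ltry.
apply/cvgr0Pnorm_le => e /H[n0 Hn0]; exists n0 => // n /Hn0 un /=.
rewrite ger0_norm ?fine_ge0// -lee_fin fineK//.
by rewrite ge0_fin_numE// (le_lt_trans un)// ltry.
Qed.

Lemma le_slack (R : realType) (a b c : R) :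
  (forall e, 0 < e < 1 -> a <= b + e * c) -> a <= b.
Proof.
move=> H; rewrite leNgt; apply/negP => ba.
have c0 : 0 < `|c| + (a - b) by rewrite ltr_wpDl// subr_gt0.
pose e := (a - b) / (2 * (`|c| + (a - b))).
have e0 : 0 < e by rewrite divr_gt0 ?subr_gt0// mulr_gt0.
have eE : e * (2 * (`|c| + (a - b))) = a - b.
  by rewrite /e mulfVK// gt_eqF// mulr_gt0.
have e1 : e < 1.
  rewrite /e ltr_pdivrMr ?mulr_gt0// mul1r; have := normr_ge0 c; lra.
have := H e; rewrite e0 e1 => /(_ isT).
have : e * c <= e * `|c| by rewrite ler_pM2l// ler_norm.
have : 0 < e * (a - b) by rewrite mulr_gt0// subr_gt0.
lra.
Qed.

Lemma int01_ge0 (R : realType) (F : R -> R) :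
  (forall t, 0 <= F t) -> (0 <= int01 F)%E.
Proof. by move=> F0; apply: integral_ge0 => t _; rewrite lee_fin. Qed.

Lemma int01_le_comb (R : realType) (F G H : R -> R) (a b : R) :
  measurable_fun (`[0, 1] : set R) F -> measurable_fun (`[0, 1] : set R) G ->
  measurable_fun (`[0, 1] : set R) H ->
  (forall t, 0 <= F t) -> (forall t, 0 <= G t) -> (forall t, 0 <= H t) ->
  0 <= a -> 0 <= b -> (forall t, F t <= a * G t + b * H t) ->
  (int01 F <= a%:E * int01 G + b%:E * int01 H)%E.
Proof.
move=> mF mG mH F0 G0 H0 a0 b0 FGH; rewrite /int01.
have mI : measurable (`[0, 1] : set R) by exact: measurable_itv.
rewrite -!ge0_integralZl_EFin//; last 4 first.
- by move=> t _; rewrite lee_fin.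
- exact/measurable_EFinP.
- by move=> t _; rewrite lee_fin.
- exact/measurable_EFinP.
rewrite -ge0_integralD//; last 4 first.
- by move=> t _; rewrite -EFinM lee_fin mulr_ge0.
- by apply/measurable_EFinP; exact: measurable_funM.
- by move=> t _; rewrite -EFinM lee_fin mulr_ge0.
- by apply/measurable_EFinP; exact: measurable_funM.
apply: ge0_le_integral => //.
- by move=> t _; rewrite lee_fin.
- exact/measurable_EFinP.
- apply/measurable_EFinP => /=; apply: measurable_funD; exact: measurable_funM.
- by move=> t _; rewrite -!EFinM -EFinD lee_fin.
Qed.

Lemma measurable_norm_sub (R : realType) (E : normedModType R) (h g : R -> E) :
  finitary h -> strongly_measurable01 g ->
  measurable_fun (`[0, 1] : set R) (fun t => `|h t - g t|).
Proof.
move=> hh [u [usimple ug]].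
apply: (measurable_fun_cvg (h := fun k t => `|h t - u k t|)).
  move=> k; apply: (measurable_finitary (fun v => `|v|)).
  exact: (finitary_comp2 (fun v w => v - w) hh (usimple k)).
move=> t /=; rewrite in_itv/= => /ug gt.
by apply: cvg_norm; apply: cvgB => //; exact: cvg_cst.
Qed.

Lemma measurable_norm (R : realType) (E : normedModType R) (g : R -> E) :
  strongly_measurable01 g -> measurable_fun (`[0, 1] : set R) (fun t => `|g t|).
Proof.
move=> sg; have := measurable_norm_sub (finitary_cst R (0 : E)) sg.
by congr measurable_fun; apply/funext => t; rewrite sub0r normrN.
Qed.

Definition sqmean (R : realType) (E : normedModType R) (x : nat -> E) N : R :=
  signmean (fun v => `|v| ^+ 2) (mkseq x N) 0.

Lemma sqmean_ge0 (R : realType) (E : normedModType R) (x : nat -> E) N :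
  0 <= sqmean x N.
Proof. by apply: signmean_ge0 => v; rewrite exprn_ge0. Qed.

Lemma sq_norm_cvx (R : realType) (E : normedModType R) :
  cvx (fun v : E => `|v| ^+ 2).
Proof. by apply: cvx_exp2 => //; exact: norm_cvx. Qed.

Lemma le_sqmean (R : realType) (E : normedModType R) (x : nat -> E) M N :
  (M <= N)%N -> sqmean x M <= sqmean x N.
Proof.
move=> MN; rewrite /sqmean /mkseq -(subnKC MN) iotaD map_cat.
by apply: le_signmean_cat; exact: sq_norm_cvx.
Qed.

Lemma int01_sq_rad (R : realType) (E : normedModType R) (x : nat -> E) N :
  int01 (fun t => `|rad_partial x N t| ^+ 2)%R = (sqmean x N)%:E.
Proof. by rewrite (int01_rad (G := fun v => `|v| ^+ 2))// => v; rewrite exprn_ge0. Qed.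

(** Young's inequality for the cross term. Being pointwise, it stands in for the triangle inequality
    in L_2 when squared norms are integrated. *)
Lemma sqr_normD_le (R : realType) (E : normedModType R) (u v : E) (e : R) :
  0 < e ->
  `|u| ^+ 2 <= (1 + e) * `|v| ^+ 2 + (1 + e^-1) * `|u - v| ^+ 2.
Proof.
move=> e0; have : `|u| <= `|v| + `|u - v|.
  by rewrite -[X in `|X| <= _](subrKC v u) ler_normD.
move: (normr_ge0 u) (normr_ge0 v) (normr_ge0 (u - v)).
move: `|u| `|v| `|u - v| => a b c a0 b0 c0 abc.
apply: (@le_trans _ _ ((b + c) ^+ 2)); first by rewrite ler_sqr ?nnegrE// addr_ge0.
have /ltW ei : 0 < e^-1 by rewrite invr_gt0.
have := mulr_ge0 ei (sqr_ge0 (e * b - c)).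
have -> : e^-1 * (e * b - c) ^+ 2 = e * b ^+ 2 + e^-1 * c ^+ 2 - 2 * b * c.
  by field; rewrite gt_eqF.
lra.
Qed.

(** Convergence in L_2 makes the square means tend to that of [g]; as they increase with [N], their
    limit is their supremum. In particular the value is the same for every representative [g]. *)
Lemma rad_sums2_norm (R : realType) (E : normedModType R) (x : nat -> E) g :
  rad_sums 2 x g ->
  exists b : R, [/\ int01 (fun t => `|g t| ^+ 2)%R = b%:E,
    forall N, sqmean x N <= b &
    forall c, (forall N, sqmean x N <= c) -> b <= c].
Proof.
move=> [[sg gfin] xg].
have pow2 (h : R -> E) : (fun t => `|h t| `^ 2) = (fun t => `|h t| ^+ 2).
  by apply/funext => t; rewrite powR_mulrn.
rewrite pow2 in gfin.
have g0 : (0 <= int01 (fun t => `|g t| ^+ 2)%R)%E.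
  by apply: int01_ge0 => t; rewrite exprn_ge0.
exists (fine (int01 (fun t => `|g t| ^+ 2)%R)).
set b := fine _; have bE : int01 (fun t => `|g t| ^+ 2)%R = b%:E.
  by rewrite fineK// ge0_fin_numE.
have b0 : 0 <= b by rewrite fine_ge0.
have D0 N : (0 <= int01 (fun t => `|rad_partial x N t - g t| `^ 2)%R)%E.
  by apply: int01_ge0 => t; exact: powR_ge0.
have {xg}cvgx := (cvg_ereal0P D0).1 xg.
have mg := measurable_norm sg.
have mS N : measurable_fun (`[0, 1] : set R) (fun t => `|rad_partial x N t|).
  apply: (measurable_finitary (fun v => `|v|)); exact: finitary_rad_partial.
have mSg N : measurable_fun (`[0, 1] : set R) (fun t => `|rad_partial x N t - g t|).
  apply: measurable_norm_sub => //; exact: finitary_rad_partial.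
have near0 (e : R) N : 0 < e -> exists2 M, (N <= M)%N &
    (int01 (fun t => `|rad_partial x M t - g t| ^+ 2)%R <= (e ^+ 2)%:E)%E.
  move=> e0; have [n0 Hn0] := cvgx (e ^+ 2) (exprn_gt0 _ e0).
  exists (maxn n0 N); first exact: leq_maxr.
  by rewrite -pow2 Hn0// leq_maxl.
split => // [N|c cub].
  (* An L_2 error of [e] contributes [(1 + e^-1) * e ^+ 2 = e ^+ 2 + e], at most [2 * e]; the factor
     [1 + e] contributes [e * b]. *)
  apply: (@le_slack _ _ _ (b + 2)) => e /andP[e0 e1].
  have [M NM hM] := near0 e N e0.
  apply: (le_trans (le_sqmean x NM)); rewrite -lee_fin -int01_sq_rad.
  apply: (@le_trans _ _ ((1 + e)%:E * b%:E + (1 + e^-1)%:E * (e ^+ 2)%:E)%E).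
    rewrite -bE; apply: (@le_trans _ _ ((1 + e)%:E * int01 (fun t => `|g t| ^+ 2)%R
        + (1 + e^-1)%:E * int01 (fun t => `|rad_partial x M t - g t| ^+ 2)%R)%E).
      apply: int01_le_comb => //.
      - exact: measurable_funX.
      - exact: measurable_funX.
      - exact: measurable_funX.
      - by rewrite addr_ge0// ltW.
      - by rewrite addr_ge0// invr_ge0 ltW.
      - by move=> t; exact: sqr_normD_le.
    by rewrite leeD2l// lee_pmul2l// lte_fin addr_gt0// invr_gt0.
  rewrite -!EFinM -EFinD lee_fin.
  have -> : (1 + e^-1) * e ^+ 2 = e ^+ 2 + e by field; rewrite gt_eqF.
  have : e ^+ 2 <= e by rewrite expr2 ger_pMl// ltW.
  lra.
apply: (@le_slack _ _ _ (c + 2)) => e /andP[e0 e1].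
have [M _ hM] := near0 e 0%N e0.
rewrite -lee_fin -bE.
apply: (@le_trans _ _ ((1 + e)%:E * (sqmean x M)%:E + (1 + e^-1)%:E * (e ^+ 2)%:E)%E).
  rewrite -int01_sq_rad; apply: (@le_trans _ _
      ((1 + e)%:E * int01 (fun t => `|rad_partial x M t| ^+ 2)%R
      + (1 + e^-1)%:E * int01 (fun t => `|rad_partial x M t - g t| ^+ 2)%R)%E).
    apply: int01_le_comb => //.
    - exact: measurable_funX.
    - exact: measurable_funX.
    - exact: measurable_funX.
    - by rewrite addr_ge0// ltW.
    - by rewrite addr_ge0// invr_ge0 ltW.
    - by move=> t; rewrite distrC; exact: sqr_normD_le.
  by rewrite leeD2l// lee_pmul2l// lte_fin addr_gt0// invr_gt0.
rewrite -!EFinM -EFinD lee_fin.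
have -> : (1 + e^-1) * e ^+ 2 = e ^+ 2 + e by field; rewrite gt_eqF.
have : e ^+ 2 <= e by rewrite expr2 ger_pMl// ltW.
have : (1 + e) * sqmean x M <= (1 + e) * c by rewrite ler_pM2l ?addr_gt0//.
lra.
Qed.

(** The common value of the two norms: [RAD_norm] always equals it, and [Rad_norm] does as soon as
    the series has a sum in L_2. *)
Definition Rad_sup (R : realType) (E : normedModType R) (x : nat -> E) : \bar R :=
  ereal_sup (range (fun N => (Num.sqrt (sqmean x N))%:E)).

Lemma L2norm01E (R : realType) (E : normedModType R) (g : R -> E) (b : R) :
  0 <= b -> int01 (fun t => `|g t| ^+ 2)%R = b%:E -> L2norm01 g = (Num.sqrt b)%:E.
Proof. by move=> b0 gb; rewrite /L2norm01 gb poweR_EFin powR12_sqrt. Qed.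

Lemma L2norm01_rad (R : realType) (E : normedModType R) (x : nat -> E) N :
  L2norm01 (rad_partial x N) = (Num.sqrt (sqmean x N))%:E.
Proof. by apply: L2norm01E; [exact: sqmean_ge0|exact: int01_sq_rad]. Qed.

Lemma Rad_normE (R : realType) (E : normedModType R) (x : nat -> E) :
  rad_sums 2 x !=set0 -> Rad_norm x = Rad_sup x.
Proof.
move=> [g0 xg0]; rewrite /Rad_norm; set g := xget _ _.
have /rad_sums2_norm[b [gb qb bc]] : rad_sums 2 x g by exact: xgetI xg0.
have b0 : 0 <= b by exact: le_trans (sqmean_ge0 x 0) (qb 0%N).
rewrite (L2norm01E b0 gb); apply/eqP; rewrite eq_le; apply/andP; split; last first.
  by apply: ge_ereal_sup => _ [N _ <-]; rewrite lee_fin ler_sqrt.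
case E1 : (Rad_sup x) => [r| |]; last 2 first.
- by rewrite leey.
- have : ((Num.sqrt (sqmean x 0))%:E <= Rad_sup x)%E.
    by apply: ereal_sup_ubound; exists 0%N.
  by rewrite E1.
have rN N : Num.sqrt (sqmean x N) <= r.
  by rewrite -lee_fin -E1; apply: ereal_sup_ubound; exists N.
have r0 : 0 <= r by exact: le_trans (sqrtr_ge0 _) (rN 0%N).
rewrite lee_fin -(ger0_norm r0) -sqrtr_sqr ler_sqrt ?sqr_ge0//.
apply: bc => N; rewrite -(sqr_sqrtr (sqmean_ge0 x N)).
by rewrite ler_sqr ?nnegrE ?sqrtr_ge0.
Qed.

Lemma simple_strongly_measurable (R : realType) (E : normedModType R) (h : R -> E) :
  finitary h -> strongly_measurable01 h.
Proof. by move=> hh; exists (fun=> h); split => // t _; exact: cvg_cst. Qed.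

Lemma rad_sums_finite (R : realType) (E : normedModType R) (x : nat -> E) N s :
  (forall n, (N <= n)%N -> x n = 0) -> 0 < s -> rad_sums s x (rad_partial x N).
Proof.
move=> x0 s0; split; first split.
- by apply: simple_strongly_measurable; exact: finitary_rad_partial.
- by rewrite (int01_rad (G := fun v => `|v| `^ s)) ?ltry// => v; exact: powR_ge0.
apply/cvg_ereal0P; first by move=> M; apply: int01_ge0 => t; exact: powR_ge0.
move=> e e0; exists N => M NM; rewrite /int01 integral0_eq ?lee_fin ?ltW// => t _.
rewrite (_ : rad_partial x M t = rad_partial x N t); last first.
  rewrite /rad_partial -(subnKC NM) big_split_ord/= [X in _ + X]big1 ?addr0// => i _.
  by rewrite x0 ?scaler0// leq_addr.
by rewrite subrr normr0 powR0// gt_eqF.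
Qed.

Lemma sqmean_truncate (R : realType) (E : normedModType R) (x : nat -> E) M N :
  sqmean (truncate_seq N x) M = sqmean x (minn M N).
Proof.
apply: EFin_inj; rewrite -!int01_sq_rad; congr int01; apply/funext => t.
congr (`|_| ^+ 2); rewrite /rad_partial.
rewrite (big_ord_widen M (fun n => rademacher n t *: x n)) ?geq_minl//.
rewrite [RHS]big_mkcond; apply: eq_bigr => i _.
rewrite /truncate_seq leq_min ltn_ord/=.
by case: ifP => // _; rewrite scaler0.
Qed.

Lemma RAD_normE (R : realType) (E : normedModType R) (x : nat -> E) :
  RAD_norm x = Rad_sup x.
Proof.
have trE N : Rad_norm (truncate_seq N x) = (Num.sqrt (sqmean x N))%:E; last first.
  by apply: (congr1 (fun u : nat -> \bar R => ereal_sup (range u))); apply/funext.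
rewrite Rad_normE; last first.
  exists (rad_partial (truncate_seq N x) N); apply: rad_sums_finite => // n Nn.
  by rewrite /truncate_seq ltnNge Nn.
rewrite /Rad_sup; apply/eqP; rewrite eq_le; apply/andP; split.
  apply: ge_ereal_sup => _ [M _ <-]; rewrite lee_fin ler_sqrt ?sqmean_ge0//.
  by rewrite sqmean_truncate le_sqmean// geq_minr.
by apply: ereal_sup_ubound; exists N => //; rewrite sqmean_truncate minnn.
Qed.

(** * Convergence of Rademacher series *)

Lemma cvg_powR (R : realType) (u : nat -> R) (l s : R) :
  0 < s -> (forall n, 0 <= u n) -> u n @[n --> \oo] --> l ->
  u n `^ s @[n --> \oo] --> l `^ s.
Proof.
move=> s0 u0 ul.
have l0 : 0 <= l.
  by rewrite -(cvg_lim _ ul)//; apply: limr_ge; [exact: cvgP ul|exact: nearW].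
have [l00|lpos] := eqVneq l 0; last first.
  have : {for l, continuous (fun x : R => x `^ s)}.
    apply: differentiable_continuous; apply/derivable1_diffP.
    by apply: derivable_powR; rewrite in_itv/= andbT lt0r lpos.
  by move=> pc; apply: (cvg_comp _ _ ul pc).
rewrite l00 in ul *; rewrite powR0 ?gt_eqF//.
apply/cvgr0Pnorm_le => e e0.
have d0 : 0 < e `^ s^-1 by exact: powR_gt0.
have /cvgr0Pnorm_le/(_ _ d0) := ul; apply: filterS => n /=.
rewrite ger0_norm// => un; rewrite ger0_norm ?powR_ge0//.
apply: (@le_trans _ _ ((e `^ s^-1) `^ s)).
  by rewrite ge0_ler_powR ?nnegrE ?powR_ge0// ltW.
by rewrite -powRrM mulVf ?gt_eqF// powRr1// ltW.
Qed.

Lemma cvg_norm_series (R : realType) (E : completeNormedModType R) (v : nat -> E) :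
  (\sum_(0 <= k <oo) (`|v k.+1 - v k|)%:E < +oo)%E -> cvgn v.
Proof.
move=> vfin.
have : cvgn [normed series (telescope v)].
  apply: nondecreasing_is_cvgn.
    by apply: nondecreasing_series => k _ _ /=; exact: normr_ge0.
  exists (fine (\sum_(0 <= k <oo) (`|v k.+1 - v k|)%:E)) => _ [n _ <-].
  rewrite -lee_fin fineK; last first.
    by rewrite ge0_fin_numE// nneseries_ge0// => k _ _; rewrite lee_fin.
  rewrite /series/= -sumEFin.
  by apply: nneseries_lim_ge => k _ _; rewrite lee_fin.
move=> /normed_cvg cv.
have -> : v = (fun n => v 0%N + series (telescope v) n).
  by apply/funext => n; exact: eq_sum_telescope.
by apply: is_cvgD => //; exact: is_cvg_cst.
Qed.

(** The Riesz-Fischer argument: the increments have summable L_1 norms, so their pointwise norm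
    series [T] is integrable, hence finite almost everywhere, and completeness of [E] gives a limit
    there. *)
Lemma simple_seq_cvg (R : realType) (E : completeNormedModType R)
    (u : nat -> R -> E) :
  (forall k, finitary (u k)) ->
  (forall k, int01 (fun t => `|u k.+1 t - u k t|)%R <= (1 / (2 ^ k.+1)%:R)%:E)%E ->
  exists g (A : set R), [/\ strongly_measurable01 g, measurable A,
    A `<=` `[0, 1], lebesgue_measure (`[0, 1] `\` A) = 0%E &
    forall t, A t -> u k t @[k --> \oo] --> g t].
Proof.
move=> ufin ucau.
pose T (t : R) := (\sum_(0 <= k <oo) (`|u k.+1 t - u k t|)%:E)%E.
have mI : measurable (`[0, 1] : set R) by exact: measurable_itv.
have mu k (D : set R) : measurable_fun D (fun t => (`|u k.+1 t - u k t|)%:E).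
  apply/measurable_EFinP; apply: (measurable_finitary (fun v => `|v|)).
  exact: (finitary_comp2 (fun v w => v - w) (ufin k.+1) (ufin k)).
have T0 t : (0 <= T t)%E by apply: nneseries_ge0 => k _ _; rewrite lee_fin.
have mT (D : set R) : measurable_fun D T.
  by apply: ge0_emeasurable_sum => // k t _ _; rewrite lee_fin.
have Tint : (@lebesgue_measure R).-integrable `[0, 1] T.
  apply/integrableP; split; first exact: mT.
  under eq_integral do rewrite gee0_abs//.
  rewrite integral_nneseries//; last by move=> k; exact: mu.
  apply: (@le_lt_trans _ _ (1%R%:E)); last by rewrite ltry.
  apply: le_trans (@epsilon_trick0 R 1 xpredT ler01).
  apply: lee_nneseries => k _; last exact: ucau.
  by move=> _; apply: integral_ge0 => t _; rewrite lee_fin.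
pose A := `[0, 1] `&` [set t | (T t < +oo)%E].
have mA : measurable A by exact: emeasurable_fun_infty_o.
have ucvg t : A t -> cvgn (u ^~ t) by move=> [_ /= Tt]; exact: cvg_norm_series.
exists (fun t => if `[< A t >] then lim (u k t @[k --> \oo]) else 0), A.
split => //.
(* Strong measurability asks for convergence at every point of the interval, so the approximants are
   cut to 0 off [A], exactly as [g] is. *)
- exists (fun k t => if `[< A t >] then u k t else 0); split.
    move=> k.
    have Afin : finitary (fun t => `[< A t >]).
      split.
        apply: (@sub_finite_set _ _ [set true; false]) => //.
        by move=> [] _; [left|right].
      move=> b; have <- : (if b then A else ~` A) = (fun t => `[< A t >]) @^-1` [set b].
        by apply/seteqP; split => t /=; case: b; case: asboolP.
      by case: b => //; exact: measurableC.
    exact: (finitary_comp2 (fun (b : bool) v => if b then v else 0) Afin (ufin k)).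
  move=> t _; case: asboolP => [At|_]; last exact: cvg_cst.
  exact: ucvg.
- exact: subIsetl.
- have [N [mN N0 AN]] : {ae (@lebesgue_measure R),
      forall t, `[0, 1]%classic t -> T t \is a fin_num}.
    by apply: integrable_ae Tint; exact: measurable_itv.
  apply: (subset_measure0 _ mN _ N0) => //; first exact: measurableD.
  move=> t [It At]; apply: AN => /= /(_ It) Tfin; apply: At; split => //=.
  by rewrite ltey_eq Tfin.
- by move=> t At; case: asboolP => // _; exact: ucvg.
Qed.

(** Fatou's lemma on [A], where the lower limit of [h k] is [F]; the complement of [A] is
    negligible. *)
Lemma int01_limit_le (R : realType) (h : nat -> R -> R) (F : R -> R)
    (A : set R) (c : R) :
  measurable A -> A `<=` `[0, 1] -> lebesgue_measure (`[0, 1] `\` A) = 0%E ->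
  measurable_fun (`[0, 1] : set R) F ->
  (forall k, measurable_fun (`[0, 1] : set R) (h k)) ->
  (forall t, 0 <= F t) -> (forall k t, 0 <= h k t) ->
  (forall t, A t -> h k t @[k --> \oo] --> F t) ->
  (forall k, (int01 (h k) <= c%:E)%E) -> (int01 F <= c%:E)%E.
Proof.
move=> mA A01 A0 mF mh F0 h0 hF hc.
have mI : measurable (`[0, 1] : set R) by exact: measurable_itv.
have mhE k : measurable_fun (`[0, 1] : set R) (fun t => (h k t)%:E).
  exact/measurable_EFinP.
rewrite /int01 (ge0_negligible_integral _ _ _ _ A0)//; last 3 first.
- exact: measurableD.
- exact/measurable_EFinP.
- by move=> t _; rewrite lee_fin.
rewrite setDD setIidr//.
have -> : (\int[@lebesgue_measure R]_(t in A) (F t)%:E =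
    \int[@lebesgue_measure R]_(t in A) limn_einf (fun k => (h k t)%:E))%E.
  apply: eq_integral => t; rewrite inE => /hF htF.
  have /cvg_limn_einf_sup[-> _] // : (h k t)%:E @[k --> \oo] --> (F t)%:E.
  by apply/fine_cvgP; split; [exact: nearW|exact: htF].
apply: (le_trans (fatou _ _ _ _)) => //.
- move=> k; apply/measurable_EFinP; exact: measurable_funS (mh k).
- by move=> k t _; rewrite lee_fin.
rewrite limn_einf_lim; apply: lime_le; first exact: is_cvg_einfs.
apply: nearW => n.
apply: (@le_trans _ _ (\int[lebesgue_measure]_(t in A) (h n t)%:E)%E).
  by apply: ereal_inf_lbound; exists n => /=.
apply: le_trans (hc n); apply: ge0_subset_integral => //.
  exact: mhE.
by move=> t _; rewrite lee_fin.
Qed.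

(** Bounding by the larger of the two norms, rather than by convexity of the power, covers exponents
    below 1 as well. *)
Lemma powR_normB (R : realType) (V : normedModType R) (a b : V) (s : R) :
  0 < s -> `|a - b| `^ s <= 2 `^ s * (`|a| `^ s + `|b| `^ s).
Proof.
move=> s0; have : `|a - b| <= 2 * Num.max `|a| `|b|.
  rewrite (le_trans (ler_normB _ _))// mulr_natl mulr2n.
  by rewrite lerD// le_max lexx ?orbT.
move=> /(ge0_ler_powR (ltW s0)) => /(_ _ _)/le_trans; apply.
- by rewrite nnegrE.
- by rewrite nnegrE mulr_ge0// le_max normr_ge0.
rewrite powRM// ler_wpM2l ?powR_ge0//.
by rewrite /Num.max; case: ifP => _; rewrite ?lerDl ?lerDr powR_ge0.
Qed.

(** Initial terms are zeroed and not shifted away, so that every remaining vector keeps its own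
    Rademacher function. *)
Definition tail_seq (E : zmodType) (N : nat) (x : nat -> E) : nat -> E :=
  fun n => if (n < N)%N then 0 else x n.

Lemma rad_partial_tail (R : realType) (E : normedModType R) (x : nat -> E) M N
    (t : R) : (N <= M)%N ->
  rad_partial (tail_seq N x) M t = rad_partial x M t - rad_partial x N t.
Proof.
move=> NM; rewrite /rad_partial -(subnKC NM) !big_split_ord/= addrAC.
rewrite subrr add0r big1 ?add0r; last first.
  by move=> i _; rewrite /tail_seq ltn_ord scaler0.
by apply: eq_bigr => i _; rewrite /tail_seq ltnNge leq_addr.
Qed.

(* Kahane's inequality upgrades square-mean Cauchy to Cauchy in every L_s;
   exponents between powers of two are reached through
   [u ^ s <= d ^ s + d ^ (s - q) * u ^ q] for [s <= q]. *)
Lemma rad_cauchy_Ls (R : realType) (E : normedModType R) (x : nat -> E) (s : R) :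
  0 < s ->
  (forall e, 0 < e -> exists n0, forall N M, (n0 <= N <= M)%N ->
    sqmean (tail_seq N x) M <= e) ->
  forall e, 0 < e -> exists n0, forall N M, (n0 <= N <= M)%N ->
    signmean (fun v => `|v| `^ s) (mkseq (tail_seq N x) M) 0 <= e.
Proof.
move=> s0 xcau e e0.
have [j sj] : exists j, s <= (2 ^ j.+1)%:R.
  have [n sn] : exists n : nat, s <= n%:R.
    by exists (Num.truncn s).+1; rewrite ltW// truncnS_gt.
  exists n; rewrite (le_trans sn)// ler_nat ltnW// (ltn_trans (ltnSn n))//.
  exact: ltn_expl.
have [K K0 HK] := @kahane R E j.
set q : R := (2 ^ j.+1)%:R in sj.
(* Norms at most [d] contribute at most [d ^ s = e / 2]; larger ones are controlled by the power
   [q], since the exponent [s - q] is nonpositive. *)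
pose d := (e / 2) `^ s^-1.
have e20 : 0 < e / 2 by rewrite divr_gt0.
have d0 : 0 < d by exact: powR_gt0.
have ds : d `^ s = e / 2 by rewrite -powRrM mulVf ?gt_eqF// powRr1// ltW.
have pw (v : E) : `|v| `^ s <= e / 2 + d `^ (s - q) * `|v| ^+ (2 ^ j.+1).
  have [vd|dv] := leP `|v| d.
    apply: (@le_trans _ _ (d `^ s)); last by rewrite ds lerDl mulr_ge0// powR_ge0.
    by rewrite ge0_ler_powR ?nnegrE// ltW.
  have v0 : 0 < `|v| by exact: lt_trans dv.
  apply: (@le_trans _ _ (d `^ (s - q) * `|v| ^+ (2 ^ j.+1))); last first.
    by rewrite lerDr ltW.
  have -> : `|v| `^ s = `|v| `^ (s - q) * `|v| `^ q.
    by rewrite -powRD ?subrK//; apply/implyP => _; rewrite gt_eqF.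
  rewrite -powR_mulrn// -/q.
  rewrite ler_pM2r ?powR_gt0// -(opprB q s) !powRN.
  rewrite lef_pV2 ?posrE ?powR_gt0// ge0_ler_powR ?nnegrE ?subr_ge0//; exact: ltW.
pose c := K * d `^ (s - q) + 1.
have c0 : 0 < c by rewrite ltr_wpDl// mulr_ge0// powR_ge0.
(* The bound [h <= 1] is there to replace [h ^+ (2 ^ j)], produced by Kahane's inequality, by
   [h]. *)
pose h := Num.min 1 ((e / 2) / c).
have h0 : 0 < h by rewrite lt_min ltr01 divr_gt0.
have h1 : h <= 1 by rewrite ge_min lexx.
have hc : h * c <= e / 2 by rewrite -ler_pdivlMr// ge_min lexx orbT.
have [n0 Hn0] := xcau h h0; exists n0 => N M /Hn0 sqh.
apply: (le_trans (le_signmean _ _ pw)).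
rewrite signmeanD signmean_cst signmeanM [leRHS]splitr lerD2l.
apply: le_trans hc.
apply: (@le_trans _ _ (d `^ (s - q) * (K * h))).
  rewrite ler_wpM2l ?powR_ge0//; apply: (le_trans (HK _)).
  rewrite ler_wpM2l//; apply: (le_trans (y := h ^+ (2 ^ j))).
    rewrite lerXn2r// nnegrE; first exact: sqmean_ge0.
    exact: ltW.
  by rewrite -[leRHS]expr1 ler_wiXn2l// ?expn_gt0// ltW.
rewrite mulrCA mulrA mulrC ler_pM2l//; first by rewrite /c lerDl.
Qed.

(** One function [g] serves all exponents: it is the almost everywhere limit of a subsequence that
    is rapidly Cauchy in L_1. For each [s], Fatou's lemma along that subsequence turns the Cauchy
    estimate in L_s into convergence to [g]. *)
Lemma rad_sums_complete (R : realType) (E : completeNormedModType R) (x : nat -> E) :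
  (forall e, 0 < e -> exists n0, forall N M, (n0 <= N <= M)%N ->
    sqmean (tail_seq N x) M <= e) ->
  forall s, 0 < s -> rad_sums s x !=set0.
Proof.
move=> xcau.
have cauE s N M : 0 < s -> (N <= M)%N ->
    (int01 (fun t => `|rad_partial x M t - rad_partial x N t| `^ s)%R =
    (signmean (fun v => `|v| `^ s) (mkseq (tail_seq N x) M) 0)%:E)%E.
  move=> s0 NM; rewrite -(int01_rad (G := fun v => `|v| `^ s)); last first.
    by move=> v; exact: powR_ge0.
  by congr int01; apply/funext => t; rewrite rad_partial_tail.
have /choice[phi phiP] : forall k : nat, exists n0, forall N M, (n0 <= N <= M)%N ->
    signmean (fun v => `|v| `^ 1) (mkseq (tail_seq N x) M) 0 <= 1 / (2 ^ k.+1)%:R :> R.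
  by move=> k; apply: rad_cauchy_Ls => //; rewrite divr_gt0// ltr0n expn_gt0.
(* The maximum makes the subsequence nondecreasing and beyond [phi k]; the summand [k] makes it
   unbounded, so that [n_ (k + N)] is at least [N]. *)
pose n_ k := (\max_(i < k.+1) phi i + k)%N.
have n_phi k : (phi k <= n_ k)%N.
  by rewrite (leq_trans _ (leq_addr _ _))// (leq_bigmax (@ord_max k)).
have n_S k : (n_ k <= n_ k.+1)%N.
  by rewrite /n_ [X in (_ <= X + _)%N]big_ord_recr/= leq_add// leq_maxl.
have [] := @simple_seq_cvg R E (fun k => rad_partial x (n_ k)).
- by move=> k; exact: finitary_rad_partial.
- move=> k; apply: le_trans (_ : (_ <= (signmean (fun v => `|v| `^ 1)
      (mkseq (tail_seq (n_ k) x) (n_ k.+1)) 0)%:E)%E) _; last first.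
    by rewrite lee_fin phiP// n_phi n_S.
  rewrite -cauE// le_eqVlt; apply/orP; left; apply/eqP; congr int01.
  by apply/funext => t; rewrite powRr1.
move=> g [A [sg mA A01 A0 Ag]] s s0; exists g.
have mg N : measurable_fun (`[0, 1] : set R) (fun t => `|rad_partial x N t - g t|).
  by apply: measurable_norm_sub => //; exact: finitary_rad_partial.
have mpow (F : R -> R) : measurable_fun (`[0, 1] : set R) F ->
    measurable_fun (`[0, 1] : set R) (fun t => F t `^ s).
  by move=> mF; apply: (measurableT_comp (measurable_powR s)).
have Scvg e : 0 < e -> exists n0, forall N, (n0 <= N)%N ->
    (int01 (fun t => `|rad_partial x N t - g t| `^ s)%R <= e%:E)%E.
  move=> e0; have [n0 Hn0] := rad_cauchy_Ls s0 xcau e0.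
  exists n0 => N n0N.
  apply: (@int01_limit_le _
    (fun k t => `|rad_partial x (n_ (k + N)%N) t - rad_partial x N t| `^ s) _ A) => //.
  - exact: mpow.
  - move=> k; apply: (measurable_finitary (fun v => `|v| `^ s)).
    by apply: (finitary_comp2 (fun v w => v - w)); exact: finitary_rad_partial.
  - move=> t /Ag tg; apply: cvg_powR => //; rewrite distrC; apply: cvg_norm.
    apply: cvgB; last exact: cvg_cst.
    by rewrite (cvg_shiftn N (fun k => rad_partial x (n_ k) t)).
  - move=> k; have Nn : (N <= n_ (k + N))%N.
      by rewrite /n_ addnA leq_addl.
    by rewrite cauE// lee_fin Hn0// n0N.
split; last by apply/cvg_ereal0P => // N; apply: int01_ge0 => t; exact: powR_ge0.
split => //; have [N HN] := Scvg 1 ltr01.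
pose c : R := 2 `^ s.
apply: (@le_lt_trans _ _ (c%:E * int01 (fun t => `|rad_partial x N t| `^ s)%R +
    c%:E * int01 (fun t => `|rad_partial x N t - g t| `^ s)%R)%E).
  apply: int01_le_comb; rewrite ?powR_ge0//.
  - by apply: mpow; exact: measurable_norm.
  - apply: (measurable_finitary (fun v => `|v| `^ s)); exact: finitary_rad_partial.
  - exact: mpow.
  move=> t; rewrite -mulrDr -{1}(subKr (rad_partial x N t) (g t)).
  exact: powR_normB.
rewrite (int01_rad (G := fun v => `|v| `^ s)); last by move=> v; exact: powR_ge0.
rewrite -EFinM; apply: lte_add_pinfty; first by rewrite ltry.
apply: (@le_lt_trans _ _ (c%:E * 1%:E)%E); last by rewrite -EFinM ltry.
by rewrite lee_pmul2l ?HN// lte_fin powR_gt0.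
Qed.

(** * Type and the coordinatewise map *)

Definition powsum (R : realType) (X : normedModType R) (p : R) (x : nat -> X) :
  \bar R := (\sum_(0 <= n <oo) (`|x n| `^ p)%:E)%E.

Lemma powsum_ge0 (R : realType) (X : normedModType R) (p : R) (x : nat -> X) :
  (0 <= powsum p x)%E.
Proof. by apply: nneseries_ge0 => n _ _; rewrite lee_fin powR_ge0. Qed.

Lemma ellp_memE (R : realType) (X : normedModType R) (p : R) (x : nat -> X) :
  0 < p -> seqmem (ellp X p) x <-> (powsum p x < +oo)%E.
Proof.
move=> p0; split; last exact: poweR_lty.
by apply: lty_poweRy; rewrite invr_eq0 gt_eqF.
Qed.

Lemma ellp_memB (R : realType) (X : normedModType R) (p : R) (x y : nat -> X) :
  0 < p -> seqmem (ellp X p) x -> seqmem (ellp X p) y ->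
  seqmem (ellp X p) (fun n => x n - y n).
Proof.
move=> p0 /(ellp_memE _ p0) xp /(ellp_memE _ p0) yp; apply/(ellp_memE _ p0).
apply: (@le_lt_trans _ _ ((2 `^ p)%:E * (powsum p x + powsum p y))%E).
  rewrite /powsum -nneseriesD; [|by move=> n _ _; rewrite lee_fin powR_ge0..].
  rewrite -nneseriesZl; last by move=> n _; rewrite -EFinD lee_fin addr_ge0// powR_ge0.
  apply: lee_nneseries => n _; first by move=> _; rewrite lee_fin powR_ge0.
  by rewrite -EFinD -EFinM lee_fin; exact: powR_normB.
apply: lte_mul_pinfty; rewrite ?lee_fin ?powR_ge0//.
exact: lte_add_pinfty.
Qed.

Lemma powsum_partial (R : realType) (X : normedModType R) (p : R) (x : nat -> X) N :
  ((\sum_(i < N) `|x i| `^ p)%R%:E <= powsum p x)%E.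
Proof.
rewrite -sumEFin -(big_mkord xpredT (fun i => (`|x i| `^ p)%:E)).
by apply: nneseries_lim_ge => n _ _; rewrite lee_fin powR_ge0.
Qed.

Lemma ellp_norm_partial (R : realType) (X : normedModType R) (p : R)
    (x : nat -> X) N : 0 < p -> seqmem (ellp X p) x ->
  (\sum_(i < N) `|x i| `^ p) `^ p^-1 <= seqnorm (ellp X p) x.
Proof.
move=> p0 /(ellp_memE _ p0) xp.
rewrite /= /ellp_norm -/(powsum p x) fine_poweR.
have s0 := powsum_ge0 p x.
rewrite ge0_ler_powR ?invr_ge0 ?(ltW p0)//.
- by rewrite nnegrE; apply: sumr_ge0 => i _; exact: powR_ge0.
- by rewrite nnegrE fine_ge0.
- by rewrite -lee_fin fineK ?ge0_fin_numE// powsum_partial.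
Qed.

Lemma powsum_finite (R : realType) (X : normedModType R) (p : R) (x : nat -> X) N :
  0 < p -> (forall n, (N <= n)%N -> x n = 0) ->
  powsum p x = (\sum_(i < N) `|x i| `^ p)%R%:E.
Proof.
move=> p0 x0; rewrite /powsum (nneseries_split 0 N); last first.
  by move=> n _; rewrite lee_fin powR_ge0.
rewrite add0n big_mkord sumEFin eseries0 ?adde0// => i Ni _.
by rewrite x0// normr0 powR0// gt_eqF.
Qed.

Lemma ellp_finite (R : realType) (X : normedModType R) (p : R) (x : nat -> X) N :
  0 < p -> (forall n, (N <= n)%N -> x n = 0) ->
  seqmem (ellp X p) x /\
  seqnorm (ellp X p) x = (\sum_(i < N) `|x i| `^ p) `^ p^-1.
Proof.
move=> p0 x0; split; first by apply/(ellp_memE _ p0); rewrite (powsum_finite p0 x0) ltry.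
by rewrite /= /ellp_norm -/(powsum p x) (powsum_finite p0 x0) fine_poweR.
Qed.

Lemma ellp_norm_ge0 (R : realType) (X : normedModType R) (p : R) (x : nat -> X) :
  0 <= seqnorm (ellp X p) x.
Proof. by rewrite /= fine_ge0// poweR_ge0. Qed.

Lemma eq_sqmean (R : realType) (E : normedModType R) (x y : nat -> E) N :
  (forall i, (i < N)%N -> x i = y i) -> sqmean x N = sqmean y N.
Proof.
move=> xy; rewrite /sqmean; congr (signmean _ _ _).
by apply/eq_in_map => i; rewrite mem_iota add0n => /andP[_]; exact: xy.
Qed.

Lemma type_ineqP (R : realType) (X E : normedModType R) (p : R) (f : X -> E)
    (C : R) :
  type_ineq p f C <-> forall N (lam : nat -> R) (x y : nat -> X),
    Num.sqrt (sqmean (fun i => lam i *: (f (x i) - f (y i))) N) <=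
    C * (\sum_(i < N) `|lam i| `^ p * `|x i - y i| `^ p) `^ p^-1.
Proof.
have L2E N (lam : nat -> R) (x y : nat -> X) :
    L2norm01 (fun t : R => \sum_(k < N)
      (lam k * rademacher k t) *: (f (x k) - f (y k))) =
    (Num.sqrt (sqmean (fun i => lam i *: (f (x i) - f (y i))) N))%:E.
  rewrite -L2norm01_rad; congr L2norm01; apply/funext => t.
  by apply: eq_bigr => i _; rewrite scalerA mulrC.
split=> H N lam x y.
  by rewrite -lee_fin -L2E; exact: (H N (fun i => lam i) (fun i => x i) (fun i => y i)).
pose ext (T : Type) (c : T) (h : 'I_N -> T) (n : nat) := oapp h c (insub n).
have extE (T : Type) (c : T) (h : 'I_N -> T) (i : 'I_N) : ext T c h i = h i.
  by rewrite /ext valK.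
have := H N (ext R 0 lam) (ext X 0 x) (ext X 0 y).
rewrite -lee_fin -L2E; congr (L2norm01 _ <= (_ * _ `^ _)%:E)%E.
  by apply/funext => t; apply: eq_bigr => i _; rewrite !extE.
by apply: eq_bigr => i _; rewrite !extE.
Qed.

Lemma type_ineq_unweighted (R : realType) (X E : normedModType R) (p : R)
    (f : X -> E) (C : R) (N : nat) (x y : nat -> X) : type_ineq p f C ->
  Num.sqrt (sqmean (fun i => f (x i) - f (y i)) N) <=
    C * (\sum_(i < N) `|x i - y i| `^ p) `^ p^-1.
Proof.
move=> /type_ineqP/(_ N (fun=> 1) x y).
under eq_bigr do rewrite normr1 powR1 mul1r.
congr (Num.sqrt _ <= _); apply: eq_sqmean => i _.
by rewrite scale1r.
Qed.

Lemma type_ineq_le (R : realType) (X E : normedModType R) (p : R)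
    (f : X -> E) (C D : R) : C <= D -> type_ineq p f C -> type_ineq p f D.
Proof.
move=> CD fC N lam x y; apply: le_trans (fC N lam x y) _.
by rewrite lee_fin ler_wpM2r// powR_ge0.
Qed.

Lemma Rad_sup_le_of_type (R : realType) (X E : normedModType R) (p : R)
    (f : X -> E) (C : R) (x y : nat -> X) :
  0 < p -> 0 <= C -> type_ineq p f C ->
  seqmem (ellp X p) (fun n => x n - y n) ->
  (Rad_sup (fun n => f (x n) - f (y n))%R <=
    (C * seqnorm (ellp X p) (fun n => x n - y n))%R%:E)%E.
Proof.
move=> p0 C0 fC xyp; apply: ge_ereal_sup => _ [N _ <-]; rewrite lee_fin.
apply: le_trans (type_ineq_unweighted _ _ _ fC) _.
rewrite ler_wpM2l//.
exact: (ellp_norm_partial (x := fun n => x n - y n)).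
Qed.

Lemma Rad_sup_ge0 (R : realType) (E : normedModType R) (x : nat -> E) :
  (0 <= Rad_sup x)%E.
Proof.
apply: (@le_trans _ _ (Num.sqrt (sqmean x 0))%:E); first by rewrite lee_fin sqrtr_ge0.
by apply: ereal_sup_ubound; exists 0%N.
Qed.

Lemma Rad_mem_of_type (R : realType) (X E : completeNormedModType R) (p : R)
    (f : X -> E) (C : R) (x y : nat -> X) :
  0 < p -> 0 < C -> type_ineq p f C ->
  seqmem (ellp X p) (fun n => x n - y n) ->
  seqmem (Rad E) (fun n => f (x n) - f (y n)).
Proof.
move=> p0 C0 fC /(ellp_memE _ p0) xyp; apply: rad_sums_complete => e e0.
(* Solves [C * d ^ (1 / p) = sqrt e]: an ell_p tail with power sum at most [d] yields a square mean
   at most [e]. *)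
pose d := (Num.sqrt e / C) `^ p.
have se0 : 0 < Num.sqrt e by rewrite sqrtr_gt0.
have seC0 : 0 < Num.sqrt e / C by rewrite divr_gt0.
have d0 : 0 < d by exact: powR_gt0.
have a0 n : (0 <= (`|x n - y n| `^ p)%:E)%E by rewrite lee_fin powR_ge0.
have tail0 n : (0 <= \sum_(n <= k <oo) (`|x k - y k| `^ p)%:E)%E.
  exact: nneseries_ge0.
have /(cvg_ereal0P tail0)/(_ d d0)[n0 Hn0] := nneseries_tail_cvg xyp (fun n _ => a0 n).
exists n0 => N M /andP[n0N NM].
(* Replacing [x] by [y] before [N] turns the tail of [f x - f y] into a sequence of increments of
   [f], to which the type inequality applies. *)
pose x' n := if (n < N)%N then y n else x n.
have -> : sqmean (tail_seq N (fun n => f (x n) - f (y n))) M =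
    sqmean (fun n => f (x' n) - f (y n)) M.
  apply: eq_sqmean => i _; rewrite /tail_seq /x'.
  by case: ifP => //; rewrite subrr.
have q0 := sqmean_ge0 (fun n => f (x' n) - f (y n)) M.
rewrite -(sqr_sqrtr q0) -(sqr_sqrtr (ltW e0)) ler_sqr ?nnegrE ?sqrtr_ge0//.
apply: le_trans (type_ineq_unweighted _ _ _ fC) _.
rewrite mulrC -ler_pdivlMr//.
rewrite -[leRHS](powRr1 (ltW seC0)) -(@mulfV _ p) ?gt_eqF// powRrM -/d.
rewrite ge0_ler_powR ?nnegrE ?invr_ge0 ?(ltW p0) ?(ltW d0)//.
  by apply: sumr_ge0 => i _; exact: powR_ge0.
have -> : \sum_(i < M) `|x' i - y i| `^ p = \sum_(N <= i < M) `|x i - y i| `^ p.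
  rewrite -(big_mkord xpredT (fun i => `|x' i - y i| `^ p)) (big_cat_nat _ NM)//=.
  rewrite big_nat big1 ?add0r.
    rewrite [LHS]big_nat [RHS]big_nat; apply: eq_bigr => i /andP[Ni _].
    by rewrite /x' ltnNge Ni.
  by move=> i /andP[_ iN]; rewrite /x' iN subrr normr0 powR0// gt_eqF.
rewrite -lee_fin; apply: le_trans (Hn0 N n0N); rewrite -sumEFin.
exact: nneseries_lim_ge.
Qed.

Lemma Rad_sup_finite (R : realType) (E : normedModType R) (z : nat -> E) N :
  (forall n, (N <= n)%N -> z n = 0) -> Rad_sup z = (Num.sqrt (sqmean z N))%:E.
Proof.
move=> z0; apply/eqP; rewrite eq_le; apply/andP; split; last first.
  by apply: ereal_sup_ubound; exists N.
apply: ge_ereal_sup => _ [M _ <-]; rewrite lee_fin ler_sqrt ?sqmean_ge0//.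
have -> : z = truncate_seq N z.
  by apply/funext => n; rewrite /truncate_seq; case: ltnP => // /z0.
by rewrite !sqmean_truncate minnn le_sqmean// geq_minr.
Qed.

(* [RAD E] and [Rad E] only enter the argument through these two properties. *)
Record type_target (R : realType) (X E : normedModType R) (p : R) (f : X -> E)
    (B : seqspace E) : Prop := TypeTarget {
  target_ge0 : forall z, 0 <= seqnorm B z;
  target_finite : forall z N, (forall n, (N <= n)%N -> z n = 0) ->
    seqnorm B z = Num.sqrt (sqmean z N);
  target_type : forall C x y, 0 < C -> type_ineq p f C ->
    seqmem (ellp X p) (fun n => x n - y n) ->
    seqmem B (fun n => f (x n) - f (y n)) /\
    seqnorm B (fun n => f (x n) - f (y n)) <=
      C * seqnorm (ellp X p) (fun n => x n - y n) }.

Lemma target_RAD (R : realType) (X E : normedModType R) (p : R) (f : X -> E) :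
  0 < p -> type_target p f (RAD E).
Proof.
move=> p0; split => [z|z N z0|C x y C0 fC xyp] /=; rewrite RAD_normE.
- by rewrite fine_ge0// Rad_sup_ge0.
- by rewrite (Rad_sup_finite z0).
have h := Rad_sup_le_of_type p0 (ltW C0) fC xyp.
split; first by exact: le_lt_trans h (ltry _).
by rewrite -lee_fin fineK// ge0_fin_numE ?Rad_sup_ge0// (le_lt_trans h)// ltry.
Qed.

Lemma target_Rad (R : realType) (X E : completeNormedModType R) (p : R)
    (f : X -> E) :
  0 < p -> type_target p f (Rad E).
Proof.
move=> p0; split => [z|z N z0|C x y C0 fC xyp].
- by rewrite /= fine_ge0// poweR_ge0.
- rewrite /= Rad_normE ?(Rad_sup_finite z0)//.
  by exists (rad_partial z N); exact: rad_sums_finite.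
have zR := Rad_mem_of_type p0 C0 fC xyp.
split=> //=; rewrite Rad_normE; last by apply: zR.
have h := Rad_sup_le_of_type p0 (ltW C0) fC xyp.
by rewrite -lee_fin fineK// ge0_fin_numE ?Rad_sup_ge0// (le_lt_trans h)// ltry.
Qed.

(** The Lipschitz bound is tested on truncated sequences. From [N] on both arguments are 0, so the
    increments vanish and the norm of [B] is an explicit square mean; this gives the unweighted
    inequality with the same constant [L]. *)
Lemma type_of_target (R : realType) (X E : normedModType R) (p : R) (f : X -> E)
    (B : seqspace E) (L : R) :
  0 < p -> type_target p f B -> 0 <= L ->
  (forall x y, seqmem (ellp X p) x -> seqmem (ellp X p) y ->
    seqnorm B (fun n => f (x n) - f (y n)) <=
      L * seqnorm (ellp X p) (fun n => x n - y n)) ->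
  type_ineq p f L.
Proof.
move=> p0 tB L0 H; apply/type_ineqP => N lam x y.
apply: type_of_unweighted => // u w.
pose u' := truncate_seq N u; pose w' := truncate_seq N w.
have tr (v : nat -> X) n : (N <= n)%N -> truncate_seq N v n = 0.
  by move=> Nn; rewrite /truncate_seq ltnNge Nn.
have trE (v : nat -> X) n : (n < N)%N -> truncate_seq N v n = v n.
  by move=> nN; rewrite /truncate_seq nN.
have := H u' w' (ellp_finite p0 (tr u)).1 (ellp_finite p0 (tr w)).1.
rewrite (@target_finite _ _ _ _ _ _ tB _ N); last first.
  by move=> n Nn; rewrite /u' /w' !tr// subrr.
have uw0 n : (N <= n)%N -> u' n - w' n = 0.
  by move=> Nn; rewrite /u' /w' !tr// subrr.
rewrite (ellp_finite p0 uw0).2.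
rewrite (@eq_sqmean _ _ _ (fun i => f (u i) - f (w i))); last first.
  by move=> i iN; rewrite /u' /w' !trE.
by under eq_bigr => i _ do rewrite /u' /w' !trE//.
Qed.

Lemma type_class_target (R : realType) (X E : normedModType R) (p : R)
    (f : X -> E) (B : seqspace E) :
  0 < p -> Lip0 f -> type_target p f B ->
  type_class p f <-> Lip0_seq (ellp X p) B (hat f).
Proof.
move=> p0 f0 tB; split=> [[_ [C C0 fC]]|[_ _ [L HL]]].
  split.
  - move=> x xp; have -> : hat f x = (fun n => f (x n) - f 0).
      by apply/funext => n; rewrite f0.2 subr0.
    apply: (target_type (y := fun=> 0) tB C0 fC _).1.
    by have -> : (fun n => x n - 0) = x by apply/funext => n; rewrite subr0.
  - by apply/funext => n; rewrite /hat f0.2.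
  - exists C => x y xp yp; apply: (target_type tB C0 fC _).2.
    exact: ellp_memB.
(* A Lipschitz constant [L] may be zero or even negative, whereas a type constant must be
   positive. *)
split => //; exists (`|L| + 1); first by rewrite ltr_wpDl.
apply: type_of_target tB _ _ => // x y xp yp.
apply: le_trans (HL x y xp yp) _; rewrite ler_wpM2r ?ellp_norm_ge0//.
by rewrite (le_trans (ler_norm L))// lerDl.
Qed.

Lemma Lip_seq_target (R : realType) (X E : normedModType R) (p : R)
    (f : X -> E) (B : seqspace E) :
  0 < p -> type_target p f B -> type_class p f ->
  Lip_seq (ellp X p) B (hat f) = type_norm p f.
Proof.
move=> p0 tB [_ [C C0 fC]].
rewrite /Lip_seq /type_norm; set S := [set r | _]; set T := [set D : R | _].
have Sle D r : T D -> S r -> r <= D.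
  move=> [D0 fD] [x [y [xp yp _ ->]]].
  have h := (target_type tB D0 fD (ellp_memB p0 xp yp)).2.
  have := ellp_norm_ge0 p (fun n => x n - y n); rewrite le_eqVlt => /predU1P[<-|d0].
    by rewrite invr0 mulr0 ltW.
  by rewrite ler_pdivrMr.
have S0 r : S r -> 0 <= r.
  move=> [x [y [_ _ _ ->]]]; apply: divr_ge0; last exact: ellp_norm_ge0.
  exact: (target_ge0 tB).
have TC : T C by [].
have supS0 : 0 <= sup S.
  have [->|/set0P[r Sr]] := eqVneq S set0; first by rewrite sup0.
  by rewrite (le_trans (S0 r Sr))// ub_le_sup//; exists C => s; exact: Sle.
apply/eqP; rewrite eq_le; apply/andP; split.
  apply: lb_le_inf; first by exists C.
  move=> D TD; have [->|Sn0] := eqVneq S set0; first by rewrite sup0; case: TD => /ltW.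
  by apply: ge_sup => [|r Sr]; [exact/set0P|exact: Sle].
(* The supremum of the quotients is itself a Lipschitz constant, and [type_of_target] keeps the
   constant; this is where equality of the norms comes from. *)
have fS : type_ineq p f (sup S).
  apply: (type_of_target p0 tB supS0) => x y xp yp.
  have h := (target_type tB C0 fC (ellp_memB p0 xp yp)).2.
  have [<-|xy] := pselect (x = y).
    rewrite (@target_finite _ _ _ _ _ _ tB _ 0%N) => [|n _]; last by rewrite subrr.
    rewrite /sqmean /= normr0 expr0n sqrtr0 mulr_ge0//; exact: ellp_norm_ge0.
  (* If the denominator is zero, [h] already bounds the numerator by [C] times 0. *)
  have := ellp_norm_ge0 p (fun n => x n - y n); rewrite le_eqVlt => /predU1P[d0|d0].
    by move: h; rewrite -d0 !mulr0.
  rewrite -ler_pdivrMr//; apply: ub_le_sup; first by exists C => s; exact: Sle.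
  by exists x, y.
(* The slack [e] is needed because [sup S] may be 0 while the infimum runs over positive constants
   only. *)
apply/ler_addgt0Pr => e e0; apply: ge_inf; first by exists 0 => D [/ltW].
split; first by rewrite ltr_wpDl.
by apply: type_ineq_le fS; rewrite lerDl ltW.
Qed.

Unset Implicit Arguments.

Theorem corollary3p5 (R : realType) (p : R) (X E : completeNormedModType R)
    (f : X -> E) (hp1 : 1 < p) (hp2 : p <= 2) (hf : Lip0 f) :
  [/\ type_class p f <-> Lip0_seq (ellp X p) (RAD E) (hat f),
      Lip0_seq (ellp X p) (RAD E) (hat f) <-> Lip0_seq (ellp X p) (Rad E) (hat f) &
      type_class p f ->
        Lip_seq (ellp X p) (RAD E) (hat f) = Lip_seq (ellp X p) (Rad E) (hat f) /\
        Lip_seq (ellp X p) (Rad E) (hat f) = type_norm p f].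
Proof.
have p0 : 0 < p by exact: lt_trans hp1.
have tRAD : type_target p f (RAD E) by exact: target_RAD.
have tRad : type_target p f (Rad E) by exact: target_Rad.
have RADP := type_class_target p0 hf tRAD.
have RadP := type_class_target p0 hf tRad.
split=> [//||fT]; first exact: iff_trans (iff_sym RADP) RadP.
by rewrite !Lip_seq_target.
Qed.
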